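(* Let $\mathcal{P}=\langle\,\Sigma\mid\mathcal{R}\,\rangle$ be a semigroup presentation. The following conditions are equivalent: (1) for some nonempty word $w\in\Sigma^+$, the diagram group $\mathcal{D}(\mathcal{P},w)$ contains a subgroup isomorphic to the R.\,Thompson group $F$; (2) the semigroup given by the presentation $\langle\,\Sigma\mid\mathcal{R}\,\rangle$ contains an idempotent.
   Context: A semigroup presentation $\mathcal{P}=\langle\,\Sigma\mid\mathcal{R}\,\rangle$ consists of an alphabet $\Sigma$ and a set $\mathcal{R}$ of relations $u=v$ with $u,v\in\Sigma^+$. A diagram over $\mathcal{P}$ is a planar labeled oriented graph built as follows: start with a horizontal positive path labeled by a word $w$ (the trivial $(w,w)$-diagram); repeatedly, choose a subpath of the current bottom path labeled $u$ (resp. $v$) for a relation $u=v$ in $\mathcal{R}$, and attach below it a new positive path with the same endpoints labeled $v$ (resp. $u$), the two paths bounding a new region (a cell). The result tessellates the region between a top path labeled $w$ and a bottom path labeled $w'$, and is called a $(w,w')$-diagram. Diagrams are considered up to isotopy of the plane. A dipole is a pair of cells such that the bottom path of the first coincides with the top path of the second and the two cells are mirror images of each other; removing dipoles reduces a diagram, and every diagram has a unique reduced form. The diagram group $\mathcal{D}(\mathcal{P},w)$ is the set of reduced $(w,w)$-diagrams with product given by gluing the bottom path of the first to the top path of the second and reducing; the identity is the trivial $(w,w)$-diagram and the inverse is the mirror image. The R.\,Thompson group $F$ is the group with presentation $\langle x_0,x_1,\ldots\mid x_j^{x_i}=x_{j+1}\ (j>i)\rangle$. *)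

(* Defs.v *)
From Stdlib Require Import Relations.
From mathcomp Require Import all_boot.
Set Implicit Arguments.
Unset Strict Implicit.
Unset Printing Implicit Defensive.

(* A semigroup presentation < S | R >: alphabet S (any type), relations     *)
(* indexed by a type I, relation i being  lhs i = rhs i.                    *)
Section Presentation.
Variables (S I : Type) (lhs rhs : I -> seq S).

Definition side (i : I) (b : bool) : seq S := if b then lhs i else rhs i.

Definition sg_step (x y : seq S) : Prop :=
  exists (p q : seq S) (i : I) (b : bool),
    x = p ++ side i b ++ q /\ y = p ++ side i (~~ b) ++ q.

Definition sg_eq : seq S -> seq S -> Prop := clos_refl_sym_trans _ sg_step.

Definition has_idempotent : Prop :=
  exists u : seq S, u <> [::] /\ sg_eq (u ++ u) u.

(* Diagrams, combinatorially: a diagram is a sequence of cells (atomic     *)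
(* diagrams), each replacing one occurrence of a side of a relation by the  *)
(* other side, considered up to commutation of independent cells           *)
(* (= isotopy); dipoles are a cell followed by its mirror image.           *)
Record cell := Cell { c_pre : seq S; c_rel : I; c_dir : bool; c_suf : seq S }.

Definition csrc (c : cell) : seq S :=
  c_pre c ++ side (c_rel c) (c_dir c) ++ c_suf c.
Definition ctgt (c : cell) : seq S :=
  c_pre c ++ side (c_rel c) (~~ c_dir c) ++ c_suf c.

Definition cflip (c : cell) : cell :=
  Cell (c_pre c) (c_rel c) (~~ c_dir c) (c_suf c).

(* cs is an (x,y)-diagram (top path labelled x, bottom path labelled y) *)
Fixpoint is_path (x : seq S) (cs : seq cell) (y : seq S) : Prop :=
  match cs with
  | [::] => x = y
  | c :: cs' => csrc c = x /\ is_path (ctgt c) cs' y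
  end.

Definition pinv (cs : seq cell) : seq cell := rev (map cflip cs).

Inductive dgen : seq cell -> seq cell -> Prop :=
| dgen_dipole c : dgen [:: c; cflip c] [::]
| dgen_commute (a m e : seq S) (i1 : I) (b1 : bool) (i2 : I) (b2 : bool) :
    dgen [:: Cell a i1 b1 (m ++ side i2 b2 ++ e);
             Cell (a ++ side i1 (~~ b1) ++ m) i2 b2 e]
         [:: Cell (a ++ side i1 b1 ++ m) i2 b2 e;
             Cell a i1 b1 (m ++ side i2 (~~ b2) ++ e)].

Definition delem (cs ds : seq cell) : Prop :=
  exists u l r v, dgen l r /\ cs = u ++ l ++ v /\ ds = u ++ r ++ v.

(* two (x,y)-diagrams are equal up to isotopy and dipoles, i.e. have the
   same reduced form; the relation only passes through (x,y)-diagrams. *)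
Definition diag_equiv (x y : seq S) : seq cell -> seq cell -> Prop :=
  clos_refl_sym_trans _
    (fun cs ds => is_path x cs y /\ is_path x ds y /\ delem cs ds).

(* Thompson's group F = < x_0, x_1, ... | x_i^-1 x_j x_i = x_{j+1} (i<j) >. *)
(* Letters (n, true) = x_n, (n, false) = x_n^-1.                           *)
Inductive Fgen : seq (nat * bool) -> seq (nat * bool) -> Prop :=
| Fgen_cancel (n : nat) (b : bool) : Fgen [:: (n, b); (n, ~~ b)] [::]
| Fgen_rel (i j : nat) : (i < j)%N ->
    Fgen [:: (i, false); (j, true); (i, true)] [:: (j.+1, true)].

Definition Fstep (W V : seq (nat * bool)) : Prop :=
  exists u l r v, Fgen l r /\ W = u ++ l ++ v /\ V = u ++ r ++ v.

Definition Feq : seq (nat * bool) -> seq (nat * bool) -> Prop :=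
  clos_refl_sym_trans _ Fstep.

Definition dimg (g : nat -> seq cell) (W : seq (nat * bool)) : seq cell :=
  flatten (map (fun a => if a.2 then g a.1 else pinv (g a.1)) W).

(* D(P,w) contains a subgroup isomorphic to F: there is an injective
   homomorphism F -> D(P,w), given by images g n of the generators x_n. *)
Definition contains_F (w : seq S) : Prop :=
  exists g : nat -> seq cell,
    (forall n, is_path w (g n) w) /\
    (forall i j, (i < j)%N ->
       diag_equiv w w (dimg g [:: (i, false); (j, true); (i, true)]) (g j.+1)) /\
    (forall W, diag_equiv w w (dimg g W) [::] -> Feq W [::]).

End Presentation.

(* Main.v *)
(* If u u = u, a diagram D from u u to u lets F act on u through
     x_0 = D^-1 (D^-1 + 1) (1 + D) D   and   x_(n+1) = D^-1 (1 + x_n) D.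
   Diagrams act on intervals by piecewise linear homeomorphisms (a word w becomes [0, |w|], a
   cell stretches its top onto its bottom), and the points where this action of x_i differs
   from that of x_(i+1), x_(i+2), ... separate the normal forms of F.

   Conversely, reduced diagrams with top w are the paths from the initial to the terminal
   vertex in a 2-dimensional analogue of a tree, whose edges are the terms of type [edge]
   below, and the diagram group acts on these edges.  An element g of infinite order has an
   axis: the non-periodic edges which every sequence of cells from g^-k w to g^k' w crosses.
   The axis is finite modulo g and is preserved by the centralizer of g, so a copy of F in
   the centralizer acts on it through a residually finite quotient, in which x_1, x_2, ...
   coincide.  For g = x_n x_(n+1)^-1 there is such a copy on either side of g; hence there are
   an edge e on an axis and y, f in F with f e = e and f (y e) = y (y e).  Moreover e and y e
   lie on a common path, since e is fixed by an element having y e on its axis.  If z is the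
   label between e and y e, and t the label of e, comparing the pairs (e, y e), (y e, y^2 e)
   and (e, y^2 e) gives z t z = z, so that z t is an idempotent. *)

Require Import Defs.
From Stdlib Require Import Relations ClassicalEpsilon.
From HB Require Import structures.
From mathcomp Require Import all_boot all_order all_algebra.
From mathcomp Require Import ring lra zify.
Set Implicit Arguments.
Unset Strict Implicit.
Unset Printing Implicit Defensive.
Import Order.TTheory GRing.Theory Num.Theory.

(** * Finite combinatorics and splittings of sequences *)

(** The bound [n2 <= size l] makes [n2 - n1] divide a factorial that depends on [l] alone, as
    [eqmod_period] requires. *)
Lemma pigeonhole (R : eqType) (l : seq R) (P : nat -> R -> Prop) :
  (forall n, exists2 r, r \in l & P n r) ->
  exists n1 n2 r, [/\ n1 < n2 <= size l, P n1 r & P n2 r].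
Proof.
move=> H; have H' n : {r | r \in l /\ P n r}.
  by apply: constructive_indefinite_description; have [r] := H n; exists r.
pose f n := sval (H' n); pose u := [seq f n | n <- iota 0 (size l).+1].
have Hu : ~~ uniq u.
  apply/negP => Uu; have := uniq_leq_size Uu (_ : {subset u <= l}).
  rewrite size_map size_iota ltnn => /(_ _)/negP; apply=> //.
  by move=> r /mapP[n _ ->]; case: (svalP (H' n)).
have [r0 _] : exists2 r, r \in l & P 0 r by apply: H.
have /(uniqPn r0)[n1 [n2 [n12]]] := Hu.
rewrite size_map size_iota => n2l; rewrite !(nth_map 0) ?size_iota //; last by lia.
rewrite !nth_iota ?add0n //; last by lia.
move=> E; exists n1, n2, (f n1); split; first by lia.
  by case: (svalP (H' n1)).
by rewrite E; case: (svalP (H' n2)).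
Qed.

Lemma split3 (T : Type) (s : seq T) a k n : size s = a + (k + n) ->
  exists s1 s2 s3 : seq T, [/\ s = s1 ++ s2 ++ s3, size s1 = a, size s2 = k & size s3 = n].
Proof.
move=> ss; exists (take a s), (take k (drop a s)), (drop (k + a) s).
rewrite -drop_drop !cat_take_drop !size_takel ?size_drop //; try lia.
by split=> //; lia.
Qed.

Lemma cat_split (T : Type) (s1 s2 t1 t2 : seq T) :
  s1 ++ s2 = t1 ++ t2 -> size s1 <= size t1 ->
  exists2 m : seq T, t1 = s1 ++ m & s2 = m ++ t2.
Proof.
elim: s1 t1 => [|z s1 IH] [|z' t1] //=; first by move=> -> _; exists [::].
  by move=> -> _; exists (z' :: t1).
by case=> -> /IH H /H[m -> ->]; exists m.
Qed.

Lemma cat_inj_size (T : Type) (s1 s2 t1 t2 : seq T) :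
  s1 ++ s2 = t1 ++ t2 -> size s1 = size t1 -> s1 = t1 /\ s2 = t2.
Proof.
move=> E sz; have [m Et Es] := cat_split E (eq_leq sz).
have : size m = 0 by move: sz; rewrite Et size_cat; lia.
by case: m Et Es => //; rewrite cats0.
Qed.

Lemma uniq_cat_inj (T : eqType) (s1 s2 t1 t2 : seq T) a : uniq (s1 ++ a :: s2) ->
  s1 ++ a :: s2 = t1 ++ a :: t2 -> s1 = t1 /\ s2 = t2.
Proof.
move=> U E; have : size s1 = size t1.
  have : index a (s1 ++ a :: s2) = index a (t1 ++ a :: t2) by rewrite E.
  have := U; rewrite {1}E in U *; move: U; rewrite !cat_uniq /= !negb_or.
  move=> /and3P[_ /andP[H1 _] _] /and3P[_ /andP[H2 _] _].
  by rewrite !index_cat (negPf H1) (negPf H2) /= eqxx !addn0.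
by move=> ss; have [-> [->]] := cat_inj_size E ss.
Qed.

Lemma iter_period (T : Type) (f : T -> T) p q a : iter p f a = a -> iter (q * p) f a = a.
Proof. by move=> E; elim: q => // q IH; rewrite mulSn iterD IH. Qed.

Lemma common_period (T : eqType) (f : T -> T) (l : seq T) :
  (forall a, a \in l -> exists2 p, 0 < p & iter p f a = a) ->
  exists2 p, 0 < p & forall a, a \in l -> iter p f a = a.
Proof.
elim: l => [|a l IH] H; first by exists 1.
have [p p0 Hp] := H a (mem_head _ _).
have [|q q0 Hq] := IH; first by move=> a' Ha'; apply: H; rewrite inE Ha' orbT.
exists (q * p); first by rewrite muln_gt0 q0.
move=> a'; rewrite inE => /predU1P[->|Ha']; first exact: iter_period.
by rewrite mulnC; apply/iter_period/Hq.
Qed.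

(** * Diagrams *)

Section Diagrams.
Variables (S I : Type) (lhs rhs : I -> seq S).
Local Notation side := (side lhs rhs).
Local Notation csrc := (csrc lhs rhs).
Local Notation ctgt := (ctgt lhs rhs).
Local Notation is_path := (is_path lhs rhs).
Local Notation "cs ~[ x , y ] ds" := (diag_equiv lhs rhs x y cs ds)
  (at level 70, format "cs  ~[ x ,  y ]  ds").
Local Notation cell := (cell S I).
Implicit Types (x y z : seq S) (c : cell) (cs ds : seq cell).

Lemma cflipK : involutive (@cflip S I).
Proof. by case=> p i b q; rewrite /cflip /= negbK. Qed.

Lemma csrc_flip c : csrc (cflip c) = ctgt c.
Proof. by []. Qed.

Lemma ctgt_flip c : ctgt (cflip c) = csrc c.
Proof. by rewrite -csrc_flip cflipK. Qed.

Lemma is_path_cat x cs ds z :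
  is_path x (cs ++ ds) z <-> exists2 y, is_path x cs y & is_path y ds z.
Proof.
elim: cs x => [|c cs IH] x /=.
  by split=> [H|[y <-]]; first by exists x.
split=> [[-> /IH[y H1 H2]]|[y [-> H1] H2]]; first by exists y.
by split=> //; apply/IH; exists y.
Qed.

Lemma is_path_catI x cs y ds z :
  is_path x cs y -> is_path y ds z -> is_path x (cs ++ ds) z.
Proof. by move=> H1 H2; apply/is_path_cat; exists y. Qed.

Lemma pinv_cons c cs : pinv (c :: cs) = rcons (pinv cs) (cflip c).
Proof. by rewrite /pinv /= rev_cons. Qed.

Lemma pinv_cat cs ds : pinv (cs ++ ds) = pinv ds ++ pinv cs.
Proof. by rewrite /pinv map_cat rev_cat. Qed.

Lemma pinvK : involutive (@pinv S I).
Proof.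
by move=> cs; rewrite /pinv map_rev revK -map_comp (eq_map cflipK) map_id.
Qed.

Lemma is_path_pinv x cs y : is_path x cs y -> is_path y (pinv cs) x.
Proof.
elim: cs x => [|c cs IH] x /= => [->|[<- /IH H]] //.
rewrite pinv_cons -cats1; apply: is_path_catI H _.
by rewrite /= csrc_flip ctgt_flip.
Qed.

Lemma dequiv_refl x y cs : cs ~[x, y] cs.
Proof. exact: rst_refl. Qed.

Lemma dequiv_sym x y cs ds : cs ~[x, y] ds -> ds ~[x, y] cs.
Proof. exact: rst_sym. Qed.

Lemma dequiv_trans x y cs ds es : cs ~[x, y] ds -> ds ~[x, y] es -> cs ~[x, y] es.
Proof. exact: rst_trans. Qed.

Lemma dequiv_ctx x y x' y' u cs ds v :
  is_path x u x' -> is_path y' v y -> cs ~[x', y'] ds ->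
  u ++ cs ++ v ~[x, y] u ++ ds ++ v.
Proof.
move=> Hu Hv; elim=> {cs ds} [cs ds [H1 [H2 [a [l [r [d [Hg [Ec Ed]]]]]]]]||cs ds _ H|cs ds es _ H1 _ H2].
- apply: rst_step; split; [|split].
  - exact: is_path_catI Hu (is_path_catI H1 Hv).
  - exact: is_path_catI Hu (is_path_catI H2 Hv).
  by exists (u ++ a), l, r, (d ++ v); rewrite Ec Ed -!catA.
- by move=> cs; apply: dequiv_refl.
- exact: dequiv_sym.
- exact: dequiv_trans H1 H2.
Qed.

Lemma dequiv_catl x y z u cs ds :
  is_path x u y -> cs ~[y, z] ds -> u ++ cs ~[x, z] u ++ ds.
Proof.
by move=> Hu H; have := dequiv_ctx (v := [::]) Hu (erefl z) H; rewrite !cats0.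
Qed.

Lemma dequiv_catr x y z cs ds v :
  is_path y v z -> cs ~[x, y] ds -> cs ++ v ~[x, z] ds ++ v.
Proof. by move=> Hv H; apply: (dequiv_ctx (u := [::]) (erefl x) Hv H). Qed.

Lemma dequiv_dgen x y cs ds : is_path x cs y -> is_path x ds y ->
  dgen lhs rhs cs ds -> cs ~[x, y] ds.
Proof.
move=> H1 H2 Hg; apply: rst_step; split=> //; split=> //.
by exists [::], cs, ds, [::]; rewrite !cats0.
Qed.

Lemma dequiv_pinvr x cs y : is_path x cs y -> cs ++ pinv cs ~[x, x] [::].
Proof.
elim: cs x => [|c cs IH] x /= => [_|[<- H]]; first exact: dequiv_refl.
rewrite pinv_cons -cats1 catA.
have Hc : is_path (csrc c) [:: c] (ctgt c) by [].
have Hf : is_path (ctgt c) [:: cflip c] (csrc c) by rewrite /= csrc_flip ctgt_flip.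
apply: dequiv_trans (dequiv_ctx Hc Hf (IH _ H)) _.
apply: dequiv_dgen; [exact: is_path_catI Hc Hf|by []|exact: dgen_dipole].
Qed.

Lemma dequiv_pinvl x cs y : is_path x cs y -> pinv cs ++ cs ~[y, y] [::].
Proof. by move=> /is_path_pinv/dequiv_pinvr; rewrite pinvK. Qed.

(** The sum of a cell with a trivial diagram on each side. The sum of two diagrams is a composite of
    two such lifts, in either order by [diag_interchange]. *)
Definition clift (p q : seq S) c : cell :=
  Cell (p ++ c_pre c) (c_rel c) (c_dir c) (c_suf c ++ q).

Lemma csrc_lift p q c : csrc (clift p q c) = p ++ csrc c ++ q.
Proof. by rewrite /csrc /= -!catA. Qed.

Lemma ctgt_lift p q c : ctgt (clift p q c) = p ++ ctgt c ++ q.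
Proof. by rewrite /ctgt /= -!catA. Qed.

Lemma is_path_lift p q x cs y :
  is_path x cs y -> is_path (p ++ x ++ q) (map (clift p q) cs) (p ++ y ++ q).
Proof.
elim: cs x => [|c cs IH] x /= => [->|[<- H]] //.
by rewrite csrc_lift ctgt_lift; split; last exact: IH.
Qed.

Lemma is_path_liftl p x cs y :
  is_path x cs y -> is_path (p ++ x) (map (clift p [::]) cs) (p ++ y).
Proof. by move=> /(is_path_lift p [::]); rewrite !cats0. Qed.

Lemma is_path_liftr q x cs y :
  is_path x cs y -> is_path (x ++ q) (map (clift [::] q) cs) (y ++ q).
Proof. exact: (is_path_lift [::] q). Qed.

Lemma clift_pinv p q cs : map (clift p q) (pinv cs) = pinv (map (clift p q) cs).
Proof. by rewrite /pinv map_rev -!map_comp. Qed.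

Lemma clift_clift p q p' q' cs :
  map (clift p q) (map (clift p' q') cs) = map (clift (p ++ p') (q' ++ q)) cs.
Proof. by rewrite -map_comp; apply: eq_map => c; rewrite /= /clift /= -!catA. Qed.

Lemma dequiv_lift p q x y cs ds : cs ~[x, y] ds ->
  map (clift p q) cs ~[p ++ x ++ q, p ++ y ++ q] map (clift p q) ds.
Proof.
elim=> {cs ds} [cs ds [H1 [H2 [a [l [r [d [Hg [Ec Ed]]]]]]]]|cs|cs ds _|cs ds es _ H1 _ H2].
- apply: rst_step; split; [exact: is_path_lift|split; first exact: is_path_lift].
  exists (map (clift p q) a), (map (clift p q) l), (map (clift p q) r), (map (clift p q) d).
  rewrite Ec Ed !map_cat; split=> //.
  case: Hg => [c|a' m e i1 b1 i2 b2]; first exact: dgen_dipole.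
  have := @dgen_commute _ _ lhs rhs (p ++ a') m (e ++ q) i1 b1 i2 b2.
  by rewrite /= /clift /= -!catA.
- exact: dequiv_refl.
- exact: dequiv_sym.
- exact: dequiv_trans H1 H2.
Qed.

Lemma dequiv_liftl p x y cs ds : cs ~[x, y] ds ->
  map (clift p [::]) cs ~[p ++ x, p ++ y] map (clift p [::]) ds.
Proof. by move=> /(dequiv_lift p [::]); rewrite !cats0. Qed.

(** [dgen_commute] moves [c] past the cells of [ds] one at a time; the gap between two cells is the
    suffix of [c] followed by the prefix of the other. *)
Lemma cell_interchange c x ds y : is_path x ds y ->
  map (clift [::] x) [:: c] ++ map (clift (ctgt c) [::]) ds ~[csrc c ++ x, ctgt c ++ y]
  map (clift (csrc c) [::]) ds ++ map (clift [::] y) [:: c].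
Proof.
elim: ds x => [|d ds IH] x /= => [->|[<- H]]; first exact: dequiv_refl.
have P1 : is_path (csrc c ++ csrc d)
   [:: clift [::] (csrc d) c; clift (ctgt c) [::] d] (ctgt c ++ ctgt d).
  by rewrite /= !csrc_lift !ctgt_lift !cats0.
have P2 : is_path (csrc c ++ csrc d)
   [:: clift (csrc c) [::] d; clift [::] (ctgt d) c] (ctgt c ++ ctgt d).
  by rewrite /= !csrc_lift !ctgt_lift !cats0.
have H1 := is_path_liftl (ctgt c) H.
apply: (@dequiv_trans _ _ _
  ([:: clift (csrc c) [::] d; clift [::] (ctgt d) c] ++ map (clift (ctgt c) [::]) ds)).
  apply: (@dequiv_catr _ _ _
    [:: clift [::] (csrc d) c; clift (ctgt c) [::] d] _ _ H1).
  apply: dequiv_dgen => //.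
  clear; case: c d => [p i b q] [p' i' b' q'].
  have := @dgen_commute _ _ lhs rhs p (q ++ p') q' i b i' b'.
  by rewrite /clift /csrc /ctgt /= !cats0 -!catA.
apply: (@dequiv_catl _ (csrc c ++ ctgt d) _ [:: clift (csrc c) [::] d] _ _ _ (IH _ H)).
by rewrite /= csrc_lift ctgt_lift !cats0.
Qed.

Lemma diag_interchange x cs y x' ds y' : is_path x cs y -> is_path x' ds y' ->
  map (clift [::] x') cs ++ map (clift y [::]) ds ~[x ++ x', y ++ y']
  map (clift x [::]) ds ++ map (clift [::] y') cs.
Proof.
move=> + Hd; elim: cs x => [|c cs IH] x /= => [->|[<- H]].
  by rewrite cats0; apply: dequiv_refl.
have Hc : is_path (csrc c ++ x') [:: clift [::] x' c] (ctgt c ++ x').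
  by rewrite /= csrc_lift ctgt_lift.
apply: dequiv_trans (dequiv_catl Hc (IH _ H)) _.
have := dequiv_catr (is_path_liftr y' H) (cell_interchange c Hd).
by rewrite /= -!catA.
Qed.

Lemma sg_eq_path x y : sg_eq lhs rhs x y -> exists cs, is_path x cs y.
Proof.
elim=> {x y} [x y [p [q [i [b [-> ->]]]]]|x|x y _ [cs /is_path_pinv H]|x y z _ [cs H1] _ [ds H2]].
- by exists [:: Cell p i b q].
- by exists [::].
- by exists (pinv cs).
- by exists (cs ++ ds); apply: is_path_catI H2.
Qed.

Lemma path_sg_eq x cs y : is_path x cs y -> sg_eq lhs rhs x y.
Proof.
elim: cs x => [|c cs IH] x /= => [->|[<- /IH H]]; first exact: rst_refl.
apply: rst_trans H; apply: rst_step.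
by exists (c_pre c), (c_suf c), (c_rel c), (c_dir c).
Qed.

Lemma sg_eq_catr x y z : sg_eq lhs rhs x y -> sg_eq lhs rhs (x ++ z) (y ++ z).
Proof. by move=> /sg_eq_path[cs /(is_path_liftr z)/path_sg_eq]. Qed.

End Diagrams.

(** * The piecewise linear action *)

Section Stretch.
Local Open Scope ring_scope.
Implicit Types (p k l t s m : rat).

Definition stretch p k l t : rat :=
  if t <= p then t else if t <= p + k then p + (t - p) * (l / k) else t - k + l.

(** In the middle case a point is given by the fraction [d] of the segment, which removes the
    quotient [l / k] from later computations. *)
Variant stretch_spec p k l t : rat -> Prop :=
| StretchLeft of t <= p : stretch_spec p k l t t
| StretchMid d of t = p + k * d & 0 < d <= 1 : stretch_spec p k l t (p + l * d)
| StretchRight of p + k < t : stretch_spec p k l t (t - k + l).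

Lemma stretchP p k l t : 0 < k -> stretch_spec p k l t (stretch p k l t).
Proof.
move=> k0; rewrite /stretch; case: leP => [|tp]; first by constructor.
case: leP => tk; last by constructor.
have k1 : k != 0 by rewrite gt_eqF.
rewrite [(t - p) * _](_ : _ = l * ((t - p) / k)); last by rewrite mulrCA.
constructor; first by rewrite mulrC divfK // addrC subrK.
by rewrite divr_gt0 ?subr_gt0 // ler_pdivrMr // mul1r lerBlDl.
Qed.

Lemma stretch_left p k l t : t <= p -> stretch p k l t = t.
Proof. by rewrite /stretch => ->. Qed.

Lemma stretch_mid p k l d :
  0 < k -> 0 <= d <= 1 -> stretch p k l (p + k * d) = p + l * d.
Proof.
move=> k0 /andP[d0 d1]; case: stretchP => // [H|d' /addrI/(mulfI (lt0r_neq0 k0)) ->|H] //.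
  by have -> : d = 0; [nra|rewrite !mulr0].
by nra.
Qed.

Lemma stretch_right p k l t : 0 < k -> p + k <= t -> stretch p k l t = t - k + l.
Proof.
move=> k0 pt; case: stretchP => // [|d tE /andP[d0 d1]]; first by move=> tp; lra.
have -> : d = 1 by apply/eqP; rewrite eq_le d1 -(ler_pM2l k0); lra.
by rewrite tE; nra.
Qed.

Lemma stretchK p k l t : 0 < k -> 0 < l -> stretch p l k (stretch p k l t) = t.
Proof.
move=> k0 l0; case: (stretchP p l t k0) => [tp|d -> /andP[d0 d1]|tp].
- by rewrite stretch_left.
- by rewrite stretch_mid // d1 ltW.
- by rewrite stretch_right //; [ring|lra].
Qed.

Lemma stretch_lt p k l : 0 < k -> 0 < l -> {homo stretch p k l : t s / t < s}.
Proof.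
move=> k0 l0 t s ts; have mid d : 0 < d -> d <= 1 ->
    [/\ 0 < k * d, k * d <= k, 0 < l * d & l * d <= l].
  by move=> d0 d1; rewrite !mulr_gt0 // !ger_pMr.
case: (stretchP p l t k0) => [tp|d tE /andP[d0 d1]|tp];
case: (stretchP p l s k0) => [sp|d' sE /andP[d0' d1']|sp]; try lra.
- by have [] := mid _ d0' d1'; lra.
- by have [] := mid _ d0 d1; lra.
- by move: ts; rewrite tE sE !ltrD2l !ltr_pM2l.
- by have [] := mid _ d0 d1; lra.
- by have [] := mid _ d0' d1'; lra.
Qed.

(** The second segment lies at distance [m >= 0] to the right of the first, which affects it only by
    the translation [l - k]. This is the commutation of independent cells. *)
Lemma stretch_comm a m k l k' l' t : 0 < k -> 0 < l -> 0 < k' -> 0 < l' -> 0 <= m ->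
  stretch (a + l + m) k' l' (stretch a k l t) =
  stretch a k l (stretch (a + k + m) k' l' t).
Proof.
move=> k0 l0 k0' l0' m0.
case: (stretchP a l t k0) => [ta|d -> /andP[d0 d1]|ta].
- by rewrite !stretch_left //; lra.
- have d2 : k * d <= k by rewrite ger_pMr.
  have d3 : l * d <= l by rewrite ger_pMr.
  rewrite (@stretch_left (a + l + m)); last by lra.
  rewrite (@stretch_left (a + k + m)); last by lra.
  by rewrite stretch_mid // d1 ltW.
case: (stretchP (a + k + m) l' t k0') => [tm|d tE /andP[d0 d1]|tm].
- by rewrite stretch_left; [rewrite stretch_right //; lra|lra].
- have d3 : 0 < l' * d by rewrite mulr_gt0.
  have -> : t - k + l = (a + l + m) + k' * d by rewrite tE; ring.
  rewrite stretch_mid //; last by rewrite d1 ltW.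
  by rewrite stretch_right //; [ring|lra].
- by rewrite !stretch_right //; [ring|lra..].
Qed.

End Stretch.

Section PLAction.
Variables (S I : Type) (lhs rhs : I -> seq S).
Hypothesis Hne : forall i, lhs i <> [::] /\ rhs i <> [::].
Local Open Scope ring_scope.
Local Notation side := (side lhs rhs).
Local Notation is_path := (is_path lhs rhs).
Local Notation "cs ~[ x , y ] ds" := (diag_equiv lhs rhs x y cs ds)
  (at level 70, format "cs  ~[ x ,  y ]  ds").
Local Notation len s := ((size s)%:R : rat).

Lemma side_gt0 i b : (0 < size (side i b))%N.
Proof.
by have [] := Hne i; rewrite /Defs.side; case: b; [case: (lhs i)|case: (rhs i)].
Qed.

Lemma side_len_gt0 i b : 0 < len (side i b).
Proof. by rewrite ltr0n side_gt0. Qed.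
Local Hint Resolve side_len_gt0 : core.

Definition cell_PL (t : rat) (c : cell S I) : rat :=
  stretch (len (c_pre c)) (len (side (c_rel c) (c_dir c)))
          (len (side (c_rel c) (~~ c_dir c))) t.

Definition PL (cs : seq (cell S I)) (t : rat) : rat := foldl cell_PL t cs.

Lemma PL_cat cs ds t : PL (cs ++ ds) t = PL ds (PL cs t).
Proof. exact: foldl_cat. Qed.

Lemma PL_lt cs : {homo PL cs : t s / t < s}.
Proof. by elim: cs => // c cs IH t s ts; apply: IH; apply: stretch_lt. Qed.

Lemma PL_dequiv x y cs ds : cs ~[x, y] ds -> PL cs =1 PL ds.
Proof.
elim=> {cs ds} [cs ds [_ [_ [u [l [r [v [Hg [-> ->]]]]]]]]|//|cs ds _ H t|cs ds es _ H1 _ H2 t].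
- move=> t; rewrite !PL_cat; congr (PL v _); move: (PL u t) => {}t.
  case: Hg => [c|a m e i1 b1 i2 b2]; rewrite /= /cell_PL /=.
    by rewrite negbK stretchK.
  by rewrite !size_cat !natrD !addrA stretch_comm.
- by rewrite H.
- by rewrite H1 H2.
Qed.

Lemma PL_pinvK cs : cancel (PL cs) (PL (pinv cs)).
Proof.
elim: cs => // c cs IH t; rewrite pinv_cons -cats1 PL_cat IH /=.
by rewrite /cell_PL /= negbK stretchK.
Qed.

Lemma PL_0 cs : PL cs 0 = 0.
Proof. by elim: cs => //= c cs IH; rewrite /cell_PL stretch_left. Qed.

Lemma PL_right x cs y t : is_path x cs y -> len x <= t ->
  PL cs t = t - len x + len y.
Proof.
elim: cs x t => [|c cs IH] x t /= => [-> _|[<- H]]; first by rewrite subrK.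
rewrite /csrc !size_cat !natrD => Ht; have s0 := ler0n rat (size (c_suf c)).
rewrite /cell_PL stretch_right ?(IH _ _ H) //; last by lra.
  by rewrite /ctgt !size_cat !natrD; ring.
by rewrite /ctgt !size_cat !natrD; lra.
Qed.

Lemma PL_lift p q cs t : PL (map (clift p q) cs) (len p + t) = len p + PL cs t.
Proof.
elim: cs t => //= c cs IH t; rewrite -IH /cell_PL /= size_cat natrD.
congr (PL _ _); rewrite /stretch lerD2l -addrA lerD2l.
case: ifP => // _; case: ifP => // _; last by rewrite !addrA.
by rewrite -addrA; congr (_ + (_ + _ * _)); ring.
Qed.

End PLAction.

(** * Generators of F built from a diagram from u u to u *)

Section IdempotentDiagrams.
Variables (S I : Type) (lhs rhs : I -> seq S).
Hypothesis Hne : forall i, lhs i <> [::] /\ rhs i <> [::].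
Local Notation is_path := (is_path lhs rhs).
Local Notation "cs ~[ x , y ] ds" := (diag_equiv lhs rhs x y cs ds)
  (at level 70, format "cs  ~[ x ,  y ]  ds").
Local Notation PL := (PL lhs rhs).

Variables (u : seq S) (D : seq (cell S I)).
Hypothesis u_neq0 : u <> [::].
Hypothesis D_path : is_path (u ++ u) D u.

Local Notation E := (pinv D).
Local Notation l := (map (clift u [::])).
Local Notation r := (map (clift [::] u)).

(** In terms of bracketings, [r E] splits the left copy of [u] and [l D] merges the two right
    copies, so (u u) u is turned into u (u u): the rotation of binary trees that represents x_0. *)
Definition idem_x0 : seq (cell S I) := E ++ r E ++ l D ++ D.
Definition idem_shift (h : seq (cell S I)) : seq (cell S I) := E ++ l h ++ D.
Definition idem_gen (n : nat) : seq (cell S I) := iter n idem_shift idem_x0.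

Let E_path : is_path u E (u ++ u).
Proof. exact: is_path_pinv. Qed.

Let lD_path : is_path (u ++ u ++ u) (l D) (u ++ u).
Proof. exact: is_path_liftl. Qed.

Let lE_path : is_path (u ++ u) (l E) (u ++ u ++ u).
Proof. exact: is_path_liftl. Qed.

Let rD_path : is_path (u ++ u ++ u) (r D) (u ++ u).
Proof. by rewrite catA; apply: is_path_liftr. Qed.

Let rE_path : is_path (u ++ u) (r E) (u ++ u ++ u).
Proof. by rewrite [u ++ u ++ u]catA; apply: is_path_liftr. Qed.

Lemma idem_shift_path h : is_path u h u -> is_path u (idem_shift h) u.
Proof.
move=> Hh; apply: is_path_catI E_path _; apply: is_path_catI D_path.
exact: is_path_liftl.
Qed.

Lemma idem_gen_path n : is_path u (idem_gen n) u.
Proof.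
elim: n => [|n IH]; last exact: idem_shift_path.
apply: is_path_catI E_path _; apply: is_path_catI rE_path _.
exact: is_path_catI lD_path D_path.
Qed.

Lemma idem_shift_dequiv h k : h ~[u, u] k -> idem_shift h ~[u, u] idem_shift k.
Proof. by move=> H; apply: dequiv_ctx E_path D_path _; apply: dequiv_liftl. Qed.

Lemma idem_shift_pinv h : pinv (idem_shift h) = idem_shift (pinv h).
Proof. by rewrite /idem_shift !pinv_cat pinvK clift_pinv catA. Qed.

Lemma idem_shift_cat h k : is_path u h u -> is_path u k u ->
  idem_shift h ++ idem_shift k ~[u, u] idem_shift (h ++ k).
Proof.
move=> Hh Hk; rewrite /idem_shift map_cat.
have H := dequiv_ctx (is_path_catI E_path (is_path_liftl u Hh))
  (is_path_catI (is_path_liftl u Hk) D_path) (dequiv_pinvr D_path).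
by rewrite -!catA /= in H *.
Qed.

(** Two factors D D^-1 cancel ([H1], [H2]). Then [r D], acting on the two left copies of [u],
    commutes with [h] on the third ([H3]) and cancels against [r E] ([H4]). *)
Lemma idem_conj_x0 h : is_path u h u ->
  pinv idem_x0 ++ idem_shift h ++ idem_x0 ~[u, u] idem_shift (idem_shift h).
Proof.
move=> Hh; have lh := is_path_liftl u Hh.
have llh : is_path (u ++ u ++ u) (map (clift (u ++ u) [::]) h) (u ++ u ++ u).
  by have := is_path_liftl (u ++ u) Hh; rewrite -!catA.
have P1 := is_path_catI E_path lE_path.
have P2 := is_path_catI lD_path D_path.
have H1 := dequiv_ctx (is_path_catI P1 rD_path)
  (is_path_catI lh (is_path_catI D_path (is_path_catI E_path (is_path_catI rE_path P2))))
  (dequiv_pinvr D_path).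
have H2 := dequiv_ctx (is_path_catI P1 (is_path_catI rD_path lh)) (is_path_catI rE_path P2)
  (dequiv_pinvr D_path).
have H3 : r D ++ l h ~[u ++ u ++ u, u ++ u] map (clift (u ++ u) [::]) h ++ r D.
  by have := diag_interchange D_path Hh; rewrite -!catA.
have {}H3 := dequiv_ctx P1 (is_path_catI rE_path P2) H3.
have H4 : r D ++ r E ~[u ++ u ++ u, u ++ u ++ u] [::].
  by rewrite clift_pinv; apply: (dequiv_pinvr rD_path).
have {}H4 := dequiv_ctx (is_path_catI P1 llh) P2 H4.
rewrite /idem_shift /idem_x0 !pinv_cat !pinvK -!clift_pinv !pinvK.
rewrite !map_cat clift_clift cats0.
rewrite -!catA in H1 H2 H3 H4 *.
apply: dequiv_trans H1 _; apply: dequiv_trans H2 _.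
by apply: dequiv_trans H3 _; apply: dequiv_trans H4 _; apply: dequiv_refl.
Qed.

(** The shift is multiplicative up to equivalence, so it carries the relation for (i, j) to that for
    (i + 1, j + 1); the case i = 0 is [idem_conj_x0]. *)
Lemma idem_gen_rel i j : (i < j)%N ->
  pinv (idem_gen i) ++ idem_gen j ++ idem_gen i ~[u, u] idem_gen j.+1.
Proof.
elim: i j => [|i IH] [//|j] ij; first exact/idem_conj_x0/idem_gen_path.
have [Hi Hj] := (idem_gen_path i, idem_gen_path j).
have Hi' := is_path_pinv Hi.
rewrite [idem_gen i.+1]/= idem_shift_pinv.
apply: (@dequiv_trans _ _ _ _ _ _ _ (idem_shift (pinv (idem_gen i) ++ idem_gen j ++ idem_gen i))).
  apply: dequiv_trans (idem_shift_cat Hi' (is_path_catI Hj Hi)).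
  apply: dequiv_catl (idem_shift_cat Hj Hi).
  exact: idem_shift_path.
exact/idem_shift_dequiv/IH.
Qed.

Local Open Scope ring_scope.
Local Notation n := ((size u)%:R : rat).

(** The left end of the right-hand part of [u] on which x_i, x_(i+1), ... are supported; in the
    usual picture of F on the unit interval it is 1 - 2^-i. *)
Fixpoint idem_pt (i : nat) : rat := if i is i'.+1 then PL D (n + idem_pt i') else 0.

Lemma idem_shift_pt h t : PL (idem_shift h) (PL D (n + t)) = PL D (n + PL h t).
Proof. by rewrite !PL_cat PL_pinvK // PL_lift. Qed.

Lemma idem_gen_fix i j : (i <= j)%N -> PL (idem_gen j) (idem_pt i) = idem_pt i.
Proof.
elim: i j => [|i IH] j ij; first exact: PL_0.
by case: j ij => // j ij; rewrite /= idem_shift_pt IH.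
Qed.

Lemma idem_gen_move i : idem_pt i.+1 < PL (idem_gen i) (idem_pt i.+1).
Proof.
elim: i => [|i IH]; last by rewrite /= idem_shift_pt; apply: PL_lt; rewrite ?ltrD2l.
have n0 : 0 < n by rewrite ltr0n; case: (u) u_neq0.
rewrite /= /idem_x0 !PL_cat PL_pinvK //.
(* The cut between the two copies of [u]: [E] stretches the left copy to length 2 n. Then [l D] and
   [D] send the point to D (n + D n), beyond D n because D n > D 0 = 0. *)
have -> : PL (r E) (n + 0) = n + n.
  have /= := PL_lift lhs rhs [::] u E (n + 0); rewrite !add0r => ->.
  by rewrite addr0 (PL_right Hne E_path) // size_cat natrD subrr add0r.
rewrite PL_lift; apply: PL_lt => //; rewrite ltrD2l.
by rewrite -[X in X < _](PL_0 lhs rhs D); apply: PL_lt.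
Qed.

End IdempotentDiagrams.

(** * Thompson's group F *)

Section FWords.
Implicit Types (W V : seq (nat * bool)) (P N : seq nat).

Lemma Feq_refl W : Feq W W.
Proof. exact: rst_refl. Qed.

Lemma Feq_sym W V : Feq W V -> Feq V W.
Proof. exact: rst_sym. Qed.

Lemma Feq_trans W V U : Feq W V -> Feq V U -> Feq W U.
Proof. exact: rst_trans. Qed.

Lemma Feq_ctx U W V T : Feq W V -> Feq (U ++ W ++ T) (U ++ V ++ T).
Proof.
elim=> {W V} [W V [a [l [r [d [Hg [-> ->]]]]]]|W|W V _|W V Z _ H1 _ H2].
- by apply: rst_step; exists (U ++ a), l, r, (d ++ T); rewrite -!catA.
- exact: Feq_refl.
- exact: Feq_sym.
- exact: Feq_trans H1 H2.
Qed.

Lemma Feq_catl U W V : Feq W V -> Feq (U ++ W) (U ++ V).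
Proof. by move=> /(Feq_ctx U [::]); rewrite !cats0. Qed.

Lemma Feq_catr W V T : Feq W V -> Feq (W ++ T) (V ++ T).
Proof. exact: (Feq_ctx [::] T). Qed.

Lemma Feq_gen W V : Fgen W V -> Feq W V.
Proof. by move=> H; apply: rst_step; exists [::], W, V, [::]; rewrite !cats0. Qed.

Lemma Feq_cancel n b W V : Feq (W ++ (n, b) :: (n, ~~ b) :: V) (W ++ V).
Proof. exact: (Feq_ctx W V (Feq_gen (Fgen_cancel n b))). Qed.

Lemma Feq_pos_pos i j : i < j ->
  Feq [:: (j, true); (i, true)] [:: (i, true); (j.+1, true)].
Proof.
move=> ij; apply: Feq_trans (Feq_catl [:: (i, true)] (Feq_gen (Fgen_rel ij))).
exact/Feq_sym/(Feq_cancel i true [::]).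
Qed.

Lemma Feq_neg_pos_lt i j : i < j ->
  Feq [:: (i, false); (j, true)] [:: (j.+1, true); (i, false)].
Proof.
move=> ij; apply: Feq_trans (Feq_catr [:: (i, false)] (Feq_gen (Fgen_rel ij))).
exact/Feq_sym/(Feq_cancel i true [:: _; _] [::]).
Qed.

Lemma Feq_neg_pos_gt i j : j < i ->
  Feq [:: (i, false); (j, true)] [:: (j, true); (i.+1, false)].
Proof.
move=> ij; have := Feq_ctx [:: (i, false)] [:: (i.+1, false)] (Feq_pos_pos ij).
move=> /= H; apply: Feq_trans (Feq_trans (Feq_sym H) _).
  exact/Feq_sym/(Feq_cancel i.+1 true [:: _; _] [::]).
exact: (Feq_cancel i false [::]).
Qed.

Definition Fpos P : seq (nat * bool) := [seq (n, true) | n <- P].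
(** The reversal makes [Fneg P] the inverse of [Fpos P]. *)
Definition Fneg P : seq (nat * bool) := rev [seq (n, false) | n <- P].

(** Insertion sort modulo the relations of F: a letter that moves right past a smaller one has its
    index raised by one. *)
Fixpoint Finsert (i : nat) P : seq nat :=
  if P is p :: P' then if i <= p then i :: P else p :: Finsert i.+1 P' else [:: i].

Lemma Finsert_eq i P : Feq (Fpos (i :: P)) (Fpos (Finsert i P)).
Proof.
elim: P i => [|p P IH] i /=; first exact: Feq_refl.
case: leqP => ip; first exact: Feq_refl.
apply: Feq_trans (Feq_catl [:: (p, true)] (IH i.+1)).
exact: (Feq_catr (Fpos P) (Feq_pos_pos ip)).
Qed.

Lemma Finsert_path i P m : m <= i -> path leq m P -> path leq m (Finsert i P).
Proof.
elim: P i m => [|p P IH] i m mi /=; first by rewrite mi.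
by case/andP=> mp sP; case: leqP => ip /=; rewrite ?mi ?ip ?mp //= IH // leqW // ltnW.
Qed.

Lemma Fpos_sorted P : exists2 Q, Feq (Fpos P) (Fpos Q) & sorted leq Q.
Proof.
elim: P => [|p P [Q H sQ]]; first by exists [::]; first exact: Feq_refl.
exists (Finsert p Q).
  by apply: Feq_trans (Finsert_eq p Q); apply: (Feq_catl [:: _] H).
case: Q sQ {H} => //= q Q sQ; case: leqP => pq /=; first by rewrite pq.
by apply: Finsert_path sQ; rewrite leqW // ltnW.
Qed.

Lemma Fneg_eq P Q : Feq (Fpos P) (Fpos Q) -> Feq (Fneg P) (Fneg Q).
Proof.
have pn R : Feq (Fpos R ++ Fneg R) [::].
  elim: R => [|p R IH]; first exact: Feq_refl.
  rewrite /Fneg /= rev_cons -cats1.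
  have := Feq_ctx [:: (p, true)] [:: (p, false)] IH.
  move=> H; rewrite catA; apply: Feq_trans H _; exact: (Feq_cancel p true [::] [::]).
have np R : Feq (Fneg R ++ Fpos R) [::].
  elim: R => [|p R IH]; first exact: Feq_refl.
  rewrite /Fneg /= rev_cons -cats1 -catA.
  exact: Feq_trans (Feq_cancel p false _ _) IH.
move=> H; apply: Feq_trans (Feq_sym _) (_ : Feq (Fneg P ++ Fpos Q ++ Fneg Q) _).
  by rewrite -[X in Feq _ X]cats0; apply: Feq_catl.
rewrite catA -[X in Feq _ X]cat0s; apply: Feq_catr.
by apply: Feq_trans (np P); apply/Feq_catl/Feq_sym.
Qed.

(** A negative letter moves right through the positive ones. Each exchange raises the larger of the
    two indices, and equal indices cancel. *)
Lemma Fpos_Fneg W : exists P N, Feq W (Fpos P ++ Fneg N).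
Proof.
elim: W => [|[i b] W [P [N H]]]; first by exists [::], [::]; apply: Feq_refl.
have {}H := Feq_catl [:: (i, b)] H.
case: b H => H; first by exists (i :: P), N.
suff [P' [N' H']] : exists P' N', Feq ((i, false) :: Fpos P) (Fpos P' ++ Fneg N').
  exists P', (N ++ N'); apply: Feq_trans H _.
  rewrite {2}/Fneg map_cat rev_cat [X in Feq _ X]catA; exact: (Feq_catr (Fneg N) H').
elim: P i {H} => [|p P IH] i; first by exists [::], [:: i]; apply: Feq_refl.
case: (ltngtP i p) => [ip|pi|<-].
- have [P' [N' H]] := IH i; exists (p.+1 :: P'), N'.
  apply: Feq_trans (Feq_catl [:: (p.+1, true)] H).
  exact: (Feq_catr _ (Feq_neg_pos_lt ip)).
- have [P' [N' H]] := IH i.+1; exists (p :: P'), N'.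
  apply: Feq_trans (Feq_catl [:: (p, true)] H).
  exact: (Feq_catr _ (Feq_neg_pos_gt pi)).
- by exists P, [::]; rewrite cats0; apply: (Feq_cancel i false [::]).
Qed.

Lemma Feq_normal_form W :
  exists P N, [/\ Feq W (Fpos P ++ Fneg N), sorted leq P & sorted leq N].
Proof.
have [P [N H]] := Fpos_Fneg W; have [P' HP sP] := Fpos_sorted P.
have [N' HN sN] := Fpos_sorted N; exists P', N'; split=> //.
apply: Feq_trans H (Feq_trans (Feq_catr _ HP) _).
exact/Feq_catl/Fneg_eq.
Qed.

End FWords.

(** * Faithfulness of the actions of F on the line *)

Section FAction.
Local Open Scope ring_scope.

(* A right action of F by increasing maps, with points t_0, t_1, ... witnessing that
   x_i moves what x_(i+1), x_(i+2), ... fix. *)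
Definition F_action (f f' : nat -> rat -> rat) (t : nat -> rat) : Prop :=
  [/\ forall i, cancel (f i) (f' i) /\ cancel (f' i) (f i),
      forall i j x, (i < j)%N -> f i (f j (f' i x)) = f j.+1 x,
      forall i, {homo f i : x y / x < y},
      forall i j, (i <= j)%N -> f j (t i) = t i &
      forall i, t i.+1 < f i (t i.+1)].

Variables (f f' : nat -> rat -> rat) (t : nat -> rat).
Hypothesis fF : F_action f f' t.

Let fK i : cancel (f i) (f' i). Proof. by case: fF => /(_ i)[]. Qed.
Let f'K i : cancel (f' i) (f i). Proof. by case: fF => /(_ i)[]. Qed.
Let f_rel i j x : (i < j)%N -> f i (f j (f' i x)) = f j.+1 x.
Proof. by case: fF => _ H _ _ _; apply: H. Qed.
Let f_lt i : {homo f i : x y / x < y}. Proof. by case: fF. Qed.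
Let f_fix i j : (i <= j)%N -> f j (t i) = t i. Proof. by case: fF => _ _ _ H _; apply: H. Qed.
Let f_move i : t i.+1 < f i (t i.+1). Proof. by case: fF. Qed.

Definition Fact (W : seq (nat * bool)) (x : rat) : rat :=
  foldl (fun x a => if a.2 then f a.1 x else f' a.1 x) x W.

Lemma Fact_cat W V x : Fact (W ++ V) x = Fact V (Fact W x).
Proof. exact: foldl_cat. Qed.

Lemma Fact_Feq W V : Feq W V -> Fact W =1 Fact V.
Proof.
elim=> {W V} [W V [u [l [r [v [Hg [-> ->]]]]]]|//|W V _ H x|W V Z _ H1 _ H2 x].
- move=> x; rewrite !Fact_cat; congr (Fact v _); move: (Fact u x) => {}x.
  by case: Hg => [n []|i j ij] /=; rewrite ?fK ?f'K ?f_rel.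
- by rewrite H.
- by rewrite H1 H2.
Qed.

(** Equal first letters are cancelled. If the first letters differ and p is the smaller one, t_(p+1)
    is fixed by the word without p, whereas the other word moves it to the right by x_p and keeps it
    there. *)
Lemma Fact_pos_inj P N : sorted leq P -> sorted leq N ->
  Fact (Fpos P) =1 Fact (Fpos N) -> P = N.
Proof.
have above i Q : all (leq i) Q -> forall x, t i.+1 < x -> t i.+1 < Fact (Fpos Q) x.
  elim: Q => [|q Q IH] //= /andP[iq sQ] x tx; apply: IH => //.
  case: (ltngtP i q) iq => // [iq|<-] _; last by apply: lt_trans (f_move i) _; apply: f_lt.
  by rewrite -(f_fix iq); apply: f_lt.
have below i Q : all (leq i.+1) Q -> Fact (Fpos Q) (t i.+1) = t i.+1.
  by elim: Q => [|q Q IH] //= /andP[iq sQ]; rewrite f_fix // IH.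
have absurd p P' N' : path leq p P' -> path leq p.+1 N' ->
    Fact (Fpos (p :: P')) =1 Fact (Fpos N') -> False.
  move=> /(order_path_min leq_trans) sP /(order_path_min leq_trans) sN /(_ (t p.+1)).
  by rewrite (below p N') //= => H; have := above _ _ sP _ (f_move p); rewrite H ltxx.
elim: P N => [|p P IH] [|n N] //= sP sN H; [|by case: (absurd p P [::])|].
  by case: (absurd n N [::]) => // x; rewrite -H.
case: (ltngtP p n) => pn.
- by case: (absurd p P (n :: N)) => //=; rewrite pn.
- by case: (absurd n N (p :: P)) => /=; rewrite ?pn.
congr (_ :: _) => //; apply: IH; [exact: path_sorted sP|exact: path_sorted sN|].
by move=> x; have := H (f' p x); rewrite /= f'K -pn f'K.
Qed.

Lemma Fact_faithful W : Fact W =1 id -> Feq W [::].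
Proof.
have [P [N [HW sP sN]]] := Feq_normal_form W => H.
suff PN : P = N.
  apply: Feq_trans HW _; rewrite PN; elim: N {PN sN} => [|n N IH]; first exact: Feq_refl.
  rewrite /Fneg /= rev_cons -cats1.
  have H1 := Feq_ctx [:: (n, true)] [:: (n, false)] IH.
  rewrite catA; apply: Feq_trans H1 _; exact: (Feq_cancel n true [::] [::]).
have negK Q x : Fact (Fpos Q) (Fact (Fneg Q) x) = x.
  elim: Q x => //= q Q IH x; rewrite /Fneg /= rev_cons -cats1 Fact_cat /=.
  by rewrite f'K IH.
apply: Fact_pos_inj => // x; have := H x; rewrite (Fact_Feq HW) Fact_cat.
by move=> /(congr1 (Fact (Fpos N))); rewrite negK.
Qed.

(** x_n x_(n+1)^-1 sends every point at or beyond t_(n+1) strictly beyond t_(n+1), hence so do its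
    positive powers. *)
Lemma Fact_bump_order n k :
  Feq (flatten (nseq k [:: (n, true); (n.+1, false)])) [::] -> k = 0%N.
Proof.
move=> /Fact_Feq/(_ (t n.+1)) /=; case: k => // k H.
have f_le i x y : x <= y -> f i x <= f i y.
  by rewrite le_eqVlt => /predU1P[->|/f_lt/ltW].
have bump x : t n.+1 <= x -> t n.+1 < Fact [:: (n, true); (n.+1, false)] x.
  move=> tx /=; rewrite ltNge; apply/negP => /(f_le n.+1); rewrite f'K f_fix //.
  by apply/negP; rewrite -ltNge (lt_le_trans (f_move n)) ?f_le.
have bumps x : t n.+1 <= x ->
    t n.+1 < Fact (flatten (nseq k.+1 [:: (n, true); (n.+1, false)])) x.
  elim: k x {H} => [|k IH] x tx; first exact: bump.
  exact/(IH (Fact [:: (n, true); (n.+1, false)] x))/ltW/bump.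
by have := bumps _ (lexx _); rewrite H ltxx.
Qed.

End FAction.

(** * From an idempotent to a copy of F *)

Section IdempotentF.
Variables (S I : Type) (lhs rhs : I -> seq S).
Hypothesis Hne : forall i, lhs i <> [::] /\ rhs i <> [::].

Lemma PL_dimg (g : nat -> seq (cell S I)) W x :
  PL lhs rhs (dimg g W) x =
  Fact (fun i => PL lhs rhs (g i)) (fun i => PL lhs rhs (pinv (g i))) W x.
Proof.
elim: W x => //= -[i b] W IH x; rewrite /dimg /= PL_cat -/(dimg g W) IH /=.
by case: b.
Qed.

Lemma idem_F_action u D : u <> [::] -> is_path lhs rhs (u ++ u) D u ->
  F_action (fun i => PL lhs rhs (idem_gen u D i))
    (fun i => PL lhs rhs (pinv (idem_gen u D i))) (idem_pt lhs rhs u D).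
Proof.
move=> u0 HD; split.
- split; first exact: PL_pinvK.
  by move=> x; have := PL_pinvK Hne (pinv (idem_gen u D i)); rewrite pinvK; apply.
- move=> i j x ij; have := PL_dequiv Hne (idem_gen_rel HD ij) x.
  by rewrite !PL_cat.
- by move=> i; apply: PL_lt.
- by move=> i j ij; apply: idem_gen_fix.
- by move=> i; apply: (idem_gen_move Hne u0 HD).
Qed.

Lemma idempotent_contains_F u : u <> [::] -> sg_eq lhs rhs (u ++ u) u ->
  contains_F lhs rhs u.
Proof.
move=> u0 /sg_eq_path[D HD]; exists (idem_gen u D).
split; first by move=> n; apply: idem_gen_path.
split=> [i j ij|W HW]; first by rewrite /dimg /= cats0; apply: idem_gen_rel.
apply: (Fact_faithful (idem_F_action u0 HD)) => x.
by rewrite -PL_dimg (PL_dequiv Hne HW).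
Qed.

End IdempotentF.

(** A fact about F alone: the action that proves it comes from the one-letter presentation with
    relation a a = a, where a single cell serves as D. *)
Lemma F_bump_order n k : Feq (flatten (nseq k [:: (n, true); (n.+1, false)])) [::] -> k = 0.
Proof.
pose lhs := fun _ : unit => [:: tt; tt]; pose rhs := fun _ : unit => [:: tt].
have HD : is_path lhs rhs ([:: tt] ++ [:: tt]) [:: Cell [::] tt true [::]] [:: tt] by [].
by apply: (Fact_bump_order (@idem_F_action _ _ lhs rhs _ _ _ _ HD)).
Qed.

(** * F acting on a set with finitely many free orbits of a central element *)

Section FreeOrbits.
Variables (T : eqType) (A : T -> Prop) (f : T -> T).
Hypothesis fA : forall e, A e -> A (f e).
Hypothesis f_inj : forall e e', A e -> A e' -> f e = f e' -> e = e'.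

Lemma iterA k e : A e -> A (iter k f e).
Proof. by move=> He; elim: k => //= k; apply: fA. Qed.

Lemma iter_inj k e e' : A e -> A e' -> iter k f e = iter k f e' -> e = e'.
Proof.
move=> He He'; elim: k => //= k IH E; apply: IH.
by apply: f_inj E; apply: iterA.
Qed.

Hypothesis f_free : forall e k, A e -> iter k f e = e -> k = 0.

Lemma iter_free e k l : A e -> iter k f e = iter l f e -> k = l.
Proof.
wlog: k l / k <= l => [H He E|kl He].
  by case/orP: (leq_total k l) => kl; [exact: H|exact/esym/(H l k)].
rewrite -(subnKC kl) iterD => E.
have /esym/(f_free He) : e = iter (l - k) f e by apply: iter_inj E => //; apply: iterA.
by move=> ->; rewrite addn0.
Qed.

Variable reps : seq T.
Hypothesis f_fin : forall e, A e ->
  exists x k l, x \in reps /\ iter k f e = iter l f x.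
Variable g : nat -> T -> T.
Hypothesis gA : forall i e, A e -> A (g i e).
Hypothesis g_inj : forall i e e', A e -> A e' -> g i e = g i e' -> e = e'.
Hypothesis gf : forall i e, A e -> g i (f e) = f (g i e).
Hypothesis g_rel : forall i j e, i < j -> A e -> g j (g i e) = g i (g j.+1 e).

(* Working modulo all powers of [f] makes the set of orbits finite; in a finite quotient of
   F the generators x_1, x_2, ... have the same image. *)
Definition eqmod q e e' := exists k l, iter (q * k) f e = iter (q * l) f e'.

Lemma eqmod_sym q e e' : eqmod q e e' -> eqmod q e' e.
Proof. by case=> k [l E]; exists l, k. Qed.

Lemma eqmod_trans q e e' e'' : eqmod q e e' -> eqmod q e' e'' -> eqmod q e e''.
Proof.
move=> [k [l E]] [k' [l' E']]; exists (k' + k), (l + l').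
by rewrite !mulnDr !iterD E -iterD addnC iterD E' -!iterD addnC.
Qed.

Lemma g_iter i k e : A e -> g i (iter k f e) = iter k f (g i e).
Proof. by move=> He; elim: k => //= k IH; rewrite gf ?IH //; apply: iterA. Qed.

Lemma eqmod_g q i e e' : A e -> A e' -> eqmod q e e' -> eqmod q (g i e) (g i e').
Proof. by move=> He He' [k [l E]]; exists k, l; rewrite -!g_iter // E. Qed.

Lemma eqmod_g_inj q i e e' : A e -> A e' -> eqmod q (g i e) (g i e') -> eqmod q e e'.
Proof.
move=> He He' [k [l E]]; exists k, l; apply: (@g_inj i); rewrite ?g_iter //; exact: iterA.
Qed.

Lemma gA_iter i k e : A e -> A (iter k (g i) e).
Proof. by move=> He; elim: k => //= k; apply: gA. Qed.

(** Modulo f^q there are at most [size R] classes, so the orbit of each class under [g 0] has a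
    period at most [size R]. The factorial is a common multiple of these periods, independent of
    [e]. *)
Lemma eqmod_period q : 0 < q -> exists2 J, 0 < J & forall e, A e -> eqmod q (iter J (g 0) e) e.
Proof.
move=> q0; pose R := [seq (x, r) | x <- reps, r <- iota 0 q].
exists (size R)`! => [|e He]; first exact: fact_gt0.
pose P n (xr : T * nat) :=
  exists k l, iter (q * k) f (iter n (g 0) e) = iter (q * l + xr.2) f xr.1.
have [n|n1 [n2 [[x r] [/andP[n12 n2s] [k1 [l1 E1]] [k2 [l2 E2]]]]]] := @pigeonhole _ R P.
  have [x [k [l [xr E]]]] := f_fin (gA_iter 0 n He).
  (* Applying f^((q-1)k) to f^k(e) = f^l(x) makes the exponent on the left a multiple of q; the
     remainder of the one on the right then names the class. *)
  pose m := l + q.-1 * k; exists (x, m %% q).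
    by apply: allpairs_f => //; rewrite mem_iota add0n ltn_mod.
  exists k, (m %/ q); rewrite /= [q * (m %/ q)]mulnC -divn_eq.
  have -> : q * k = q.-1 * k + k by case: q q0 {P R m} => // q _ /=; lia.
  by rewrite iterD E -iterD addnC.
have E12 : eqmod q (iter n1 (g 0) e) (iter n2 (g 0) e).
  exists (l2 + k1), (l1 + k2); rewrite !mulnDr !iterD E1 E2 /= -!iterD.
  by rewrite addnCA.
have {}E12 : eqmod q (iter (n2 - n1) (g 0) e) e.
  have : n1 <= n2 by lia.
  move: E12 => {P n12 n2s E1 E2}; elim: n1 n2 => [|n1 IH] n2.
    by rewrite subn0 => /eqmod_sym.
  case: n2 => // n2 /= /eqmod_g_inj H; rewrite subSS => n12; apply: IH => //.
  by apply: H; apply: gA_iter.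
have : n2 - n1 %| (size R)`! by apply: dvdn_fact; rewrite subn_gt0 n12 (leq_trans (leq_subr _ _)).
case/dvdnP=> m ->; elim: m => [|m IH]; first by rewrite mul0n; exists 0, 0.
rewrite mulSn iterD; apply: eqmod_trans E12.
move: (iter (m * _) _ _) IH (gA_iter 0 (m * (n2 - n1)) He) => d Hd HA.
by elim: (n2 - n1) => //= n IHn; apply: eqmod_g => //; apply: gA_iter.
Qed.

(** As g_0^J is trivial modulo f^q, conjugation by it gives g_(i+J) = g_i modulo f^q for i > 0. The
    relation between g_j and g_(j+J) then becomes g_j g_j = g_j g_(j+J+1), and g_j can be
    cancelled. *)
Lemma eqmod_succ q j e : 0 < q -> 0 < j -> A e -> eqmod q (g j.+1 e) (g j e).
Proof.
move=> q0 j0 He; have [J J0 HJ] := eqmod_period q0.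
have shift m i d : 0 < i -> A d -> g i (iter m (g 0) d) = iter m (g 0) (g (i + m) d).
  move=> i0 Hd; elim: m i i0 => [|m IH] i i0 /=; first by rewrite addn0.
  by rewrite g_rel ?IH ?addSnnS //; apply: gA_iter.
have per i d : 0 < i -> A d -> eqmod q (g (i + J) d) (g i d).
  move=> i0 Hd; apply: eqmod_trans (eqmod_sym (HJ _ _)) _; first exact: gA.
  by rewrite -shift //; apply: eqmod_g (HJ _ _) => //; apply: gA_iter.
have jJ : j < j + J by lia.
have E : eqmod q (g j (g (j + J).+1 e)) (g j (g j e)).
  by rewrite -g_rel //; apply: per => //; apply: gA.
apply: eqmod_trans (eqmod_g_inj _ _ E); [|exact: gA|exact: gA].
by apply: eqmod_sym; rewrite -addSn; apply: per.
Qed.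

(** With q = 1 the two values differ by some f^d. Taking q = d + 1 and using freeness, d + 1 divides
    d, so d = 0. *)
Lemma free_orbits_succ j e : 0 < j -> A e -> g j.+1 e = g j e.
Proof.
move=> j0 He; have [k [l]] := @eqmod_succ 1 j e isT j0 He; rewrite !mul1n.
have [Hu Hv] : A (g j.+1 e) /\ A (g j e) by split; apply: gA.
have Hq q := @eqmod_succ q.+1 j e isT j0 He.
move: (g j.+1 e) (g j e) Hu Hv Hq => u v Hu Hv Hq.
wlog kl : u v k l Hu Hv Hq / k <= l => [H|].
  case/orP: (leq_total k l) => kl E; first exact: H kl E.
  by apply/esym/(H v u l k) => // q; apply/eqmod_sym.
rewrite -(subnKC kl) iterD => /iter_inj Eu.
have {}Eu : u = iter (l - k) f v by apply: Eu => //; apply: iterA.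
have [k' [l']] := Hq (l - k); rewrite Eu -iterD => /(iter_free Hv) E.
suff d0 : l - k = 0 by rewrite d0.
have : (l - k).+1 %| l - k.
  by rewrite -(dvdn_addr (l - k) (dvdn_mulr k' (dvdnn (l - k).+1))) E dvdn_mulr.
by case: (l - k) => // d /dvdn_leq; lia.
Qed.

End FreeOrbits.

(** * The universal 2-tree *)

(* Edges of the universal 2-tree over a base word: [New i b s j] is the j-th bottom edge of
   the cell of relation i (read from side b) hanging below the segment s. *)
Inductive edge (I : Type) : Type :=
  Base (j : nat) | New (i : I) (b : bool) (s : seq (edge I)) (j : nat).
Arguments Base {I} j.

(** Equality is decided classically, since [I] is an arbitrary type. *)
Definition edge_eqb (I : Type) (e e' : edge I) : bool :=
  if excluded_middle_informative (e = e') then true else false.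

Lemma edge_eqP (I : Type) : Equality.axiom (@edge_eqb I).
Proof.
by move=> e e'; rewrite /edge_eqb; case: excluded_middle_informative; constructor.
Qed.

HB.instance Definition _ (I : Type) := hasDecEq.Build (edge I) (@edge_eqP I).

Lemma edge_induction (I : Type) (P : edge I -> Prop) :
  (forall j, P (Base j)) ->
  (forall i b s j, (forall e, e \in s -> P e) -> P (New i b s j)) ->
  forall e, P e.
Proof.
move=> HB HN; fix IH 1 => -[j|i b s j]; first exact: HB.
apply: HN; elim: s => [|e s IHs] e' He'; first by exfalso; rewrite in_nil in He'.
by move: He'; rewrite inE => /orP[/eqP->|He']; [exact: (IH e)|exact: IHs].
Qed.

Section TwoTree.
Variables (S I : Type) (lhs rhs : I -> seq S).
Hypothesis Hne : forall i, lhs i <> [::] /\ rhs i <> [::].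
Local Notation side := (side lhs rhs).
Local Notation csrc := (csrc lhs rhs).
Local Notation ctgt := (ctgt lhs rhs).
Local Notation is_path := (is_path lhs rhs).
Local Notation "cs ~[ x , y ] ds" := (diag_equiv lhs rhs x y cs ds)
  (at level 70, format "cs  ~[ x ,  y ]  ds").
Local Notation edge := (edge I).
Local Notation cell := (cell S I).
Local Notation sz i b := (size (side i b)).
Implicit Types (e : edge) (s L A B M : seq edge) (c : cell) (cs ds : seq cell)
  (v w x y : seq S).

Definition News i b s : seq edge := [seq New i b s j | j <- iota 0 (sz i (~~ b))].

(** If [s] is already the bottom of the mirror cell, attaching would form a dipole, so the result is
    the top of that cell. The first edge of [s] is enough to find the only candidate for it. *)
Definition attach i b s : seq edge :=
  if s is New _ _ s' _ :: _ then
    if s == News i (~~ b) s' then s' else News i b s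
  else News i b s.

Lemma size_News i b s : size (News i b s) = sz i (~~ b).
Proof. by rewrite size_map size_iota. Qed.

Lemma mem_NewsP i b s e :
  reflect (exists2 j, e = New i b s j & j < sz i (~~ b)) (e \in News i b s).
Proof.
apply: (iffP mapP) => [[j]|[j -> jk]]; first by rewrite mem_iota => jk ->; exists j.
by exists j; rewrite ?mem_iota.
Qed.

Lemma News_head i b s : exists L, News i b s = New i b s 0 :: L.
Proof.
rewrite /News; have := side_gt0 Hne i (~~ b).
by case: (size _) => //= n _; eexists.
Qed.

Lemma News_inj i b s i' b' s' : News i b s = News i' b' s' -> [/\ i = i', b = b' & s = s'].
Proof.
by have [L ->] := News_head i b s; have [L' ->] := News_head i' b' s' => -[-> -> ->].
Qed.

Variant attach_spec i b s : seq edge -> Prop :=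
| AttachCancel s' of s = News i (~~ b) s' : attach_spec i b s s'
| AttachNew of (forall s', s <> News i (~~ b) s') : attach_spec i b s (News i b s).

Lemma attachP i b s : attach_spec i b s (attach i b s).
Proof.
rewrite /attach; case: s => [|[j|i' b' s' j] s].
- by constructor=> s'; have [L ->] := News_head i (~~ b) s'.
- by constructor=> s'; have [L ->] := News_head i (~~ b) s'.
case: eqP => [H|H]; constructor=> // s'' H'; apply: H.
have [L EL] := News_head i (~~ b) s''.
by have := H'; rewrite {1}EL => -[_ _ E _ _]; rewrite H' E.
Qed.

Lemma attach_cancel i b s : attach i b (News i (~~ b) s) = s.
Proof.
case: attachP => [s' /News_inj[]|] // H; by case: (H s).
Qed.

Lemma attach_new i b s : (forall s', s <> News i (~~ b) s') -> attach i b s = News i b s.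
Proof. by case: attachP => // s' -> /(_ s'). Qed.

(** * Positions of edges, and paths without repetition *)

Section Positions.
Local Open Scope ring_scope.

(** The bottom edges of a cell share evenly the interval of its top, whose endpoints are kept.
    Intervals abut along a path, so no edge occurs twice ([chain_uniq]). The default (0, 0) matters
    only for an empty [s], which [wf] excludes. *)
Fixpoint lohi e : rat * rat :=
  match e with
  | Base j => (j%:R, j.+1%:R)
  | New i b s j =>
      let ps := map lohi s in
      let a := (head (0, 0) ps).1 in
      let d := ((last (0, 0) ps).2 - a) / (sz i (~~ b))%:R in
      (a + d * j%:R, a + d * j.+1%:R)
  end.
Local Notation lo e := (lohi e).1.
Local Notation hi e := (lohi e).2.

Fixpoint chain (a : rat) L (z : rat) : Prop :=
  if L is e :: L' then [/\ lo e = a, a < hi e & chain (hi e) L' z] else a = z.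

Lemma chain_cat a A B z : chain a (A ++ B) z <-> exists2 m, chain a A m & chain m B z.
Proof.
elim: A a => [|e A IH] a /=; first by split=> [H|[m <-]]; first by exists a.
split=> [[H1 H2 /IH[m H3 H4]]|[m [H1 H2 H3] H4]]; first by exists m.
by split=> //; apply/IH; exists m.
Qed.

Lemma chain_le a L z : chain a L z -> a <= z.
Proof. by elim: L a => [|e L IH] a /= => [->|[_ H /IH]] //; lra. Qed.

Lemma chain_lo a L z e : chain a L z -> e \in L -> a <= lo e.
Proof.
elim: L a => [|e' L IH] a //= [H1 H2 H3]; rewrite inE => /predU1P[->|/(IH _ H3)]; lra.
Qed.

Lemma chain_uniq a L z : chain a L z -> uniq L.
Proof.
elim: L a => //= e L IH a [H1 H2 H3]; rewrite (IH _ H3) andbT.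
by apply/negP => /(chain_lo H3); lra.
Qed.

Lemma chain_head a L z : L != [::] -> chain a L z -> (head (0, 0) (map lohi L)).1 = a.
Proof. by case: L => //= e L _ []. Qed.

Lemma chain_last a L z : L != [::] -> chain a L z -> (last (0, 0) (map lohi L)).2 = z.
Proof.
case: L => //= e L _ [_ _]; elim: L e => [|e' L IH] e /=; first by [].
by move=> [_ _ /IH].
Qed.

Lemma chain_lt a L z : L != [::] -> chain a L z -> a < z.
Proof. by case: L => //= e L _ [_ H1 /chain_le]; lra. Qed.

Lemma chain_News i b s a z : s != [::] -> chain a s z -> chain a (News i b s) z.
Proof.
move=> s0 Hs; have az := chain_lt s0 Hs; rewrite /News.
have k0 := side_len_gt0 Hne i (~~ b).
set d := (z - a) / (sz i (~~ b))%:R.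
have d0 : 0 < d by rewrite divr_gt0 // subr_gt0.
suff H n j : chain (a + d * j%:R) [seq New i b s j | j <- iota j n] (a + d * (j + n)%:R).
  have := H (sz i (~~ b)) 0%N; rewrite mulr0 addr0 add0n divfK ?lt0r_neq0 //.
  by rewrite addrC subrK.
elim: n j => [|n IH] j /=; first by rewrite addn0.
rewrite (chain_head s0 Hs) (chain_last s0 Hs) -/d; split=> //.
  by rewrite ltrD2l ltr_pM2l // ltr_nat.
by rewrite -addSnnS.
Qed.

(** The last clause of [wf_New] is reducedness: no cell hangs directly below its mirror image. It
    makes [attach] invertible ([attachK]). *)
Inductive wf : edge -> Prop :=
| wf_Base j : wf (Base j)
| wf_New i b s j : (forall e, e \in s -> wf e) -> (exists a z, chain a s z) ->
    size s = sz i b -> (forall s', s <> News i (~~ b) s') -> wf (New i b s j).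

Definition good n L := [/\ size L = n, forall e, e \in L -> wf e & exists a z, chain a L z].

Lemma good_News i b s : good (sz i b) s -> (forall s', s <> News i (~~ b) s') ->
  forall e, e \in News i b s -> wf e.
Proof. by move=> [H1 H2 H3] H4 e /mem_NewsP[j -> _]; apply: wf_New. Qed.

Lemma News_good i b s n : good n (News i b s) ->
  good (sz i b) s /\ (forall s', s <> News i (~~ b) s').
Proof.
have [L E] := News_head i b s; case=> _ H _.
have : wf (New i b s 0) by apply: H; rewrite E mem_head.
by move=> Hw; inversion Hw; subst.
Qed.

Lemma attachK i b s : good (sz i b) s -> attach i (~~ b) (attach i b s) = s.
Proof.
case: (attachP i b s) => [s' ->|H] Hs; last by rewrite -{2}[b]negbK attach_cancel.
by have [_ H] := News_good Hs; rewrite attach_new.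
Qed.

Lemma attach_good_aux i b s a z : good (sz i b) s -> chain a s z ->
  [/\ size (attach i b s) = sz i (~~ b), forall e, e \in attach i b s -> wf e &
      chain a (attach i b s) z].
Proof.
move=> Hs Hc; have s0 : s != [::].
  by case: Hs; have := side_gt0 Hne i b; case: s Hc => //= _; lia.
case: attachP => [s' Es|H]; last first.
  by split; [rewrite size_News|apply: good_News Hs H|apply: chain_News].
have := Hs; rewrite Es => /News_good[[H1 H2 [a' [z' H3]]] _]; split=> //.
have s0' : s' != [::] by have := side_gt0 Hne i (~~ b); case: s' H1 {Es H2 H3} => //= <-.
have Hn := chain_News i (~~ b) s0' H3; rewrite -Es in Hn.
by rewrite -(chain_head s0 Hc) -(chain_last s0 Hc) (chain_head s0 Hn) (chain_last s0 Hn).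
Qed.

Lemma attach_good i b s : good (sz i b) s -> good (sz i (~~ b)) (attach i b s).
Proof.
move=> Hs; have [_ _ [a [z Hc]]] := Hs.
by have [H1 H2 H3] := attach_good_aux Hs Hc; split=> //; exists a, z.
Qed.

End Positions.

(** * The action of diagrams on paths of the 2-tree *)

Definition actc L c : seq edge :=
  let p := size (c_pre c) in let k := sz (c_rel c) (c_dir c) in
  take p L ++ attach (c_rel c) (c_dir c) (take k (drop p L)) ++ drop (p + k) L.

Definition run L cs : seq edge := foldl actc L cs.

Lemma actcE A s B c : size A = size (c_pre c) -> size s = sz (c_rel c) (c_dir c) ->
  actc (A ++ s ++ B) c = A ++ attach (c_rel c) (c_dir c) s ++ B.
Proof.
move=> sA ss; rewrite /actc -sA -ss.
have -> : drop (size A + size s) (A ++ s ++ B) = B.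
  by rewrite catA drop_size_cat // size_cat.
by rewrite take_size_cat // drop_size_cat // take_size_cat.
Qed.

Lemma good_cat n A B : good n (A ++ B) -> good (size A) A /\ good (size B) B.
Proof.
case=> _ H [a [z /chain_cat[m H1 H2]]]; split; split=> //.
- by move=> e eA; apply: H; rewrite mem_cat eA.
- by exists a, m.
- by move=> e eB; apply: H; rewrite mem_cat eB orbT.
- by exists m, z.
Qed.

Variant cell_split L c : Prop :=
  CellSplit A s B of L = A ++ s ++ B & size A = size (c_pre c) &
    good (sz (c_rel c) (c_dir c)) s & size B = size (c_suf c) &
    actc L c = A ++ attach (c_rel c) (c_dir c) s ++ B.

Lemma cell_splitP c L : good (size (csrc c)) L -> cell_split L c.
Proof.
move=> HL; have [sL _ _] := HL; rewrite /csrc !size_cat in sL.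
have [A [s [B [EL sA ss sB]]]] := split3 sL; move: HL; rewrite EL.
by move=> /good_cat[_ /good_cat[]]; rewrite ss => Hs _; apply: CellSplit; rewrite ?actcE.
Qed.

Lemma actc_good c L : good (size (csrc c)) L -> good (size (ctgt c)) (actc L c).
Proof.
move=> HL; have [A s B E sA Hs sB ->] := cell_splitP HL.
have [_ Hw [a [z Hc]]] := HL; move: Hc Hw; rewrite E.
move=> /chain_cat[m1 H1 /chain_cat[m2 H2 H3]] Hw.
have [h1 h2 h3] := attach_good_aux Hs H2; split.
- by rewrite !size_cat h1 sA sB.
- move=> e; rewrite !mem_cat => /or3P[eA|/h2 //|eB]; apply: Hw; rewrite !mem_cat.
    by rewrite eA.
  by rewrite eB !orbT.
by exists a, z; apply/chain_cat; exists m1 => //; apply/chain_cat; exists m2.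
Qed.

Lemma run_cat L cs ds : run L (cs ++ ds) = run (run L cs) ds.
Proof. exact: foldl_cat. Qed.

Lemma run_good x cs y L : is_path x cs y -> good (size x) L -> good (size y) (run L cs).
Proof.
by elim: cs x L => [|c cs IH] x L /= => [->|[<- H] HL] //; apply: IH H (actc_good HL).
Qed.

Lemma actc_flip c L : good (size (csrc c)) L -> actc (actc L c) (cflip c) = L.
Proof.
move=> HL; have [A s B E sA Hs sB ->] := cell_splitP HL.
by rewrite actcE //= ?attachK ?E //; case: (attach_good Hs).
Qed.

Lemma run_dequiv x y cs ds L : cs ~[x, y] ds -> good (size x) L -> run L cs = run L ds.
Proof.
move=> H HL; elim: H => {cs ds}
  [cs ds [H1 [_ [u [l [r [v [Hg [Ec Ed]]]]]]]]|//|//|cs ds es _ H1 _ H2]; last by rewrite H1.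
rewrite Ec Ed !run_cat; congr (run _ v); move: H1; rewrite Ec.
case/is_path_cat=> x' /run_good/(_ HL); move: (run L u) => {}L {}HL.
case/is_path_cat=> y' + _; case: Hg => [c|a m e i1 b1 i2 b2] /= [Ex [_ _]].
  by rewrite actc_flip // Ex.
have := HL; rewrite -Ex => HL'; have [A s B E sA Hs sB -> /=] := cell_splitP HL'.
have sB' := sB; rewrite /= !size_cat in sB'; have [ss _ _] := Hs; rewrite /= in ss.
have [sa _ _] := attach_good Hs; rewrite /= in sa sA.
have [Bm [B2 [B3 [EB s1 s2 s3]]]] := split3 sB'.
rewrite E EB; set A1 := attach i1 b1 s.
have -> : A ++ A1 ++ Bm ++ B2 ++ B3 = (A ++ A1 ++ Bm) ++ B2 ++ B3 by rewrite -!catA.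
have -> : A ++ s ++ Bm ++ B2 ++ B3 = (A ++ s ++ Bm) ++ B2 ++ B3 by rewrite -!catA.
rewrite !(@actcE _ B2) /= ?size_cat ?sa ?sA ?ss ?s1 //.
by rewrite -!catA actcE.
Qed.

(** * Reduced diagrams and faithfulness of the action *)

Definition base v : seq edge := [seq Base j | j <- iota 0 (size v)].

Lemma base_good v : good (size v) (base v).
Proof.
split; first by rewrite size_map size_iota.
  by move=> e /mapP[j _ ->]; constructor.
exists 0%R, (size v)%:R%R; rewrite /base.
suff H n j : chain j%:R%R [seq Base j | j <- iota j n] (j + n)%:R%R by apply: (H _ 0).
elim: n j => [|n IH] j /=; first by rewrite addn0.
by split=> //; [rewrite ltr_nat|rewrite -addSnnS].
Qed.

Lemma good_uniq n L : good n L -> uniq L.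
Proof. by case=> _ _ [a [z /chain_uniq]]. Qed.

(** [newonly] is the form in which reducedness of diagrams is used: no cell closes a dipole, so each
    one creates new edges. *)
Definition newstep L c := exists A s B, [/\ L = A ++ s ++ B, size A = size (c_pre c),
  size s = sz (c_rel c) (c_dir c) &
  attach (c_rel c) (c_dir c) s = News (c_rel c) (c_dir c) s].

Fixpoint newonly L cs : Prop :=
  if cs is c :: cs' then newstep L c /\ newonly (actc L c) cs' else True.

Lemma newonly_rcons L cs c :
  newonly L (rcons cs c) <-> newonly L cs /\ newstep (run L cs) c.
Proof.
elim: cs L => [|d cs IH] L /=; first by split=> [[]|[]].
by split=> [[? /IH[]]|[[? ?] ?]] //; split=> //; apply/IH.
Qed.

(** If all bottom edges of a cell are still on the final path, no later cell has touched them, so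
    this cell can be commuted to the end. *)
Lemma last_cell w cs v p i b q A s B :
  newonly (base w) cs -> is_path w cs v -> v = p ++ side i (~~ b) ++ q ->
  run (base w) cs = A ++ News i b s ++ B -> size A = size p ->
  exists cs', [/\ newonly (base w) cs', is_path w cs' (p ++ side i b ++ q),
    run (base w) cs' = A ++ s ++ B & cs ~[w, v] rcons cs' (Cell p i b q)].
Proof.
elim/last_ind: cs v p q A B => [|cs d IH] v p q A B.
  move=> _ _ _ /= E _; have [L EL] := News_head i b s.
  have : New i b s 0 \in base w by rewrite E EL mem_cat mem_head orbT.
  by case/mapP.
move=> /newonly_rcons[Hn [A0 [s0 [B0 [E0 sA0 ss0 Hatt]]]]] Hp Ev.
have Hg := run_good Hp (base_good w).
move: Hp; rewrite -cats1 => /is_path_cat[v0 Hp /= [Ev0 Ev1]].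
rewrite run_cat /= E0 actcE // Hatt => E sA.
have Hg' : good (size v) (A ++ News i b s ++ B).
  by move: Hg; rewrite -cats1 run_cat /= E0 actcE // Hatt E.
have [Hs _] : good (sz i b) s /\ (forall s', s <> News i (~~ b) s').
  by have [_ /good_cat[/(News_good)]] := good_cat Hg'.
have [ss _ _] := Hs; case: d E0 sA0 ss0 Hatt Ev0 Ev1 Hg E => p0 i0 b0 q0 /= E0 sA0 ss0 Hatt.
rewrite /csrc /ctgt /= => Ev0 Ev1 Hg E.
have Ev2 : p ++ side i (~~ b) ++ q = p0 ++ side i0 (~~ b0) ++ q0 by rewrite Ev1.
(* If the last cell lies to the right or to the left of the segment, the induction hypothesis brings
   the wanted cell to just before it, and the two commute. *)
have [H|H] := leqP (size A + sz i (~~ b)) (size A0).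
- have [m EA0 EB] : exists2 m, A0 = (A ++ News i b s) ++ m & B = m ++ News i0 b0 s0 ++ B0.
    by apply: cat_split; rewrite -?catA // size_cat size_News.
  have [n Ep0 Eq] : exists2 n, p0 = (p ++ side i (~~ b)) ++ n & q = n ++ side i0 (~~ b0) ++ q0.
    by apply: cat_split; rewrite -?catA // size_cat -sA -sA0.
  have sm : size m = size n.
    by move: sA0; rewrite EA0 Ep0 !size_cat size_News sA; lia.
  have [] := IH v0 p (n ++ side i0 b0 ++ q0) A (m ++ s0 ++ B0) Hn Hp.
  - by rewrite -Ev0 Ep0 -!catA.
  - by rewrite E0 EA0 -!catA.
  - by [].
  move=> cs' [Hn' Hp' Er' He'].
  exists (rcons cs' (Cell (p ++ side i b ++ n) i0 b0 q0)); split.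
  - apply/newonly_rcons; split=> //; exists (A ++ s ++ m), s0, B0; split=> //=.
      by rewrite Er' -!catA.
    by rewrite !size_cat sA ss sm.
  - rewrite -cats1; apply: is_path_catI Hp' _; rewrite /= /csrc /ctgt /= Eq -!catA.
    by split.
  - rewrite -cats1 run_cat /= Er' EB.
    have -> : A ++ s ++ m ++ s0 ++ B0 = (A ++ s ++ m) ++ s0 ++ B0 by rewrite -!catA.
    by rewrite actcE ?Hatt -?catA //= !size_cat sA ss sm.
  rewrite -!cats1 -catA; apply: dequiv_trans (dequiv_catr _ He') _.
    by split=> //; rewrite /csrc /= Ev0.
  rewrite -cats1 -catA; apply: dequiv_catl Hp' _; rewrite Ep0 Eq -catA.
  apply: dequiv_dgen; [| |exact: dgen_commute]; rewrite /= /csrc /ctgt /= Ev Eq -!catA //.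
have [H'|H'] := leqP (size A0 + sz i0 (~~ b0)) (size A).
- have [m EA EB] : exists2 m, A = (A0 ++ News i0 b0 s0) ++ m & B0 = m ++ News i b s ++ B.
    by apply: cat_split; rewrite -?catA // size_cat size_News.
  have [n Ep Eq] : exists2 n, p = (p0 ++ side i0 (~~ b0)) ++ n & q0 = n ++ side i (~~ b) ++ q.
    by apply: cat_split; rewrite -?catA // size_cat -sA -sA0.
  have sm : size m = size n.
    by move: sA; rewrite EA Ep !size_cat size_News sA0; lia.
  have [] := IH v0 (p0 ++ side i0 b0 ++ n) q (A0 ++ s0 ++ m) B Hn Hp.
  - by rewrite -Ev0 Eq -!catA.
  - by rewrite E0 EB -!catA.
  - by rewrite !size_cat sA0 ss0 sm.
  move=> cs' [Hn' Hp' Er' He'].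
  exists (rcons cs' (Cell p0 i0 b0 (n ++ side i b ++ q))); split.
  - apply/newonly_rcons; split=> //; exists A0, s0, (m ++ s ++ B); split=> //=.
    by rewrite Er' -!catA.
  - rewrite -cats1; apply: is_path_catI Hp' _; rewrite /= /csrc /ctgt /= Ep -!catA.
    by split.
  - rewrite -cats1 run_cat /= Er' EA.
    have -> : (A0 ++ s0 ++ m) ++ s ++ B = A0 ++ s0 ++ m ++ s ++ B by rewrite -!catA.
    by rewrite actcE ?Hatt -?catA.
  rewrite -!cats1 -catA; apply: dequiv_trans (dequiv_catr _ He') _.
    by split=> //; rewrite /csrc /= Ev0.
  rewrite -cats1 -catA; apply: dequiv_catl Hp' _; rewrite Ep Eq -!catA.
  apply: dequiv_sym.
  apply: dequiv_dgen; [| |exact: dgen_commute]; rewrite /= /csrc /ctgt /= Ev Ep -!catA //.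
(* The two groups of edges overlap, hence coincide since a path has no repeated edge. *)
have Hu : uniq (A ++ News i b s ++ B) := good_uniq Hg'.
have Enews k : size A <= k < size A + sz i (~~ b) ->
    nth (Base 0) (A ++ News i b s ++ B) k = New i b s (k - size A).
  move=> Hk; rewrite !nth_cat size_News ltnNge.
  have -> : size A <= k by lia.
  have -> /= : k - size A < sz i (~~ b) by lia.
  by rewrite (nth_map 0) ?size_iota ?nth_iota //; lia.
have Enews0 k : size A0 <= k < size A0 + sz i0 (~~ b0) ->
    nth (Base 0) (A ++ News i b s ++ B) k = New i0 b0 s0 (k - size A0).
  move=> Hk; rewrite -E !nth_cat size_News ltnNge.
  have -> : size A0 <= k by lia.
  have -> /= : k - size A0 < sz i0 (~~ b0) by lia.
  by rewrite (nth_map 0) ?size_iota ?nth_iota //; lia.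
have k0 := side_gt0 Hne i (~~ b); have k0' := side_gt0 Hne i0 (~~ b0).
have [sAA Ei Eb Es] : [/\ size A = size A0, i = i0, b = b0 & s = s0].
  have : New i b s (maxn (size A) (size A0) - size A) =
         New i0 b0 s0 (maxn (size A) (size A0) - size A0).
    by rewrite -Enews ?Enews0 //; lia.
  by case=> -> -> ->; split=> //; lia.
subst i0 b0 s0; have [EA /cat_inj_size H1] := cat_inj_size E (esym sAA).
have spp : size p = size p0 by rewrite -sA -sA0.
have [Epp /cat_inj_size H2] := cat_inj_size Ev2 spp.
have [_ EB] := H1 erefl; have [_ Eqq] := H2 erefl.
exists cs; split=> //.
- by rewrite Epp Eqq Ev0.
- by rewrite -EA -EB.
- by rewrite Epp Eqq cats1; apply: dequiv_refl.
Qed.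

(** Cells are added one by one. A cell that would close a dipole finds its partner moved to the end
    by [last_cell], and both are removed. *)
Lemma newonly_exists w cs v : is_path w cs v ->
  exists cs', [/\ newonly (base w) cs', is_path w cs' v & cs ~[w, v] cs'].
Proof.
elim/last_ind: cs v => [|cs d IH] v Hp.
  by exists [::]; split=> //; apply: dequiv_refl.
move: Hp; rewrite -cats1 => /is_path_cat[v0 /IH[cs' [Hn Hp He]] /= [E0 E1]].
have Hd : is_path v0 [:: d] v by split.
have He' := dequiv_catr Hd He.
have := run_good Hp (base_good w); rewrite -E0 => Hg.
have [A s B EL sA Hs sB EA] := cell_splitP Hg.
case: (attachP (c_rel d) (c_dir d) s) => [s' Es|Hnew]; last first.
  exists (rcons cs' d); split.
  - apply/newonly_rcons; split=> //; exists A, s, B; split=> //; first by case: Hs.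
    exact: attach_new.
  - by rewrite -cats1; apply: is_path_catI Hd.
  - by rewrite -cats1.
have Ev0 : v0 = c_pre d ++ side (c_rel d) (~~ ~~ c_dir d) ++ c_suf d by rewrite -E0 negbK.
have EL' : run (base w) cs' = A ++ News (c_rel d) (~~ c_dir d) s' ++ B by rewrite EL Es.
have [cs'' [Hn'' Hp'' Er'' He'']] := last_cell Hn Hp Ev0 EL' sA.
exists cs''; split=> //; first by rewrite -E1.
apply: dequiv_trans He' (dequiv_trans (dequiv_catr Hd He'') _).
rewrite -cats1 -catA -[X in _ ~[_, _] X]cats0 -E1; apply: dequiv_catl Hp'' _.
apply: dequiv_dgen; [|by []|by have := dgen_dipole lhs rhs (cflip d); rewrite cflipK].
by rewrite /= /csrc /ctgt /= !negbK.
Qed.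

(** A nonempty reduced sequence ends by creating edges [New], which are not on the base. *)
Lemma run_faithful w cs : is_path w cs w -> run (base w) cs = base w -> cs ~[w, w] [::].
Proof.
move=> Hp Hr; have [cs' [Hn Hp' He]] := newonly_exists Hp.
have {}Hr : run (base w) cs' = base w.
  by rewrite -(run_dequiv He) //; apply: base_good.
apply: dequiv_trans He _; move: Hr.
case/lastP: cs' Hn {Hp'} => [|cs' d]; first by move=> *; apply: dequiv_refl.
move=> /newonly_rcons[_ [A [s [B [E sA ss Hatt]]]]].
rewrite -cats1 run_cat /= E actcE // Hatt => Hr; exfalso.
have [L EL] := News_head (c_rel d) (c_dir d) s.
have : New (c_rel d) (c_dir d) s 0 \in base w by rewrite -Hr EL mem_cat mem_head orbT.
by case/mapP.
Qed.

(** * The action of diagrams on edges *)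

(** Transports the tree so that its base becomes the path [M]. Cells are attached afresh, because a
    cell below the base may cancel against one that ends on [M]. *)
Fixpoint subst M e : edge :=
  match e with
  | Base j => nth (Base 0) M j
  | New i b s j => nth (Base 0) (attach i b (map (subst M) s)) j
  end.

Lemma subst_News M i b s : good (sz i b) (map (subst M) s) ->
  map (subst M) (News i b s) = attach i b (map (subst M) s).
Proof.
move=> /(attach_good)[sX _ _]; rewrite -map_comp /=.
by rewrite -[RHS](mkseq_nth (Base 0)) sX.
Qed.

Inductive sgood M : edge -> Prop :=
| sgood_Base j : sgood M (Base j)
| sgood_New i b s j : (forall e, e \in s -> sgood M e) ->
    good (sz i b) (map (subst M) s) -> sgood M (New i b s j).

Lemma sgood_NewP M i b s j : sgood M (New i b s j) ->
  (forall e, e \in s -> sgood M e) /\ good (sz i b) (map (subst M) s).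
Proof. by move=> H; inversion H. Qed.

(** Transport commutes with attaching cells. The invariant [sgood] ensures that the segments
    transported are genuine paths, so that [attachK] settles the cancelling case. *)
Lemma subst_run v M cs y : good (size v) M -> is_path v cs y ->
  map (subst M) (run (base v) cs) = run M cs.
Proof.
move=> HM; suff H : is_path v cs y -> map (subst M) (run (base v) cs) = run M cs /\
  (forall e, e \in run (base v) cs -> sgood M e) by move/H => [].
elim/last_ind: cs y => [|cs d IH] y Hp.
  split; last by move=> e /mapP[j _ ->]; constructor.
  have [sM _ _] := HM; rewrite /= /base -sM -map_comp.
  exact: mkseq_nth.
move: Hp; rewrite -cats1 !run_cat => /is_path_cat[v0 Hp /= [E0 E1]].
have [IH1 IH2] := IH _ Hp.
have := run_good Hp (base_good v); rewrite -E0 => /cell_splitP[A s B EL sA Hs sB ->].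
have [ss _ _] := Hs.
have HgM := run_good Hp HM; move: HgM; rewrite -IH1 EL !map_cat => HgM.
have [_ /good_cat[Hss _]] := good_cat HgM; rewrite size_map ss in Hss.
rewrite actcE ?size_map //.
have IH2' e : e \in A ++ s ++ B -> sgood M e by rewrite -EL; apply: IH2.
suff [E Hg] : map (subst M) (attach (c_rel d) (c_dir d) s) =
     attach (c_rel d) (c_dir d) (map (subst M) s) /\
     forall e, e \in attach (c_rel d) (c_dir d) s -> sgood M e.
  split; first by rewrite E.
  move=> e; rewrite !mem_cat => /or3P[eA|/Hg //|eB]; apply: IH2'; rewrite !mem_cat ?eA //.
  by rewrite eB !orbT.
have {}IH2 e : e \in s -> sgood M e by move=> es; apply: IH2'; rewrite !mem_cat es orbT.
case: (attachP (c_rel d) (c_dir d) s) => [s' Es|Hnew].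
  have [L EN] := News_head (c_rel d) (~~ c_dir d) s'.
  have : sgood M (New (c_rel d) (~~ c_dir d) s' 0) by apply: IH2; rewrite Es EN mem_head.
  move=> /sgood_NewP[Hs1 Hs2]; split=> //.
  by rewrite Es subst_News // -{1}[c_dir d]negbK attachK.
split; first by rewrite subst_News.
by move=> e /mem_NewsP[j -> _]; constructor.
Qed.

(** A left action, by [sub_cat]: a diagram from [w] to [v] maps the tree over [v] to the tree over
    [w]. *)
Definition sub w cs e : edge := subst (run (base w) cs) e.

(** The type [edge] also has terms outside the tree; the laws of the action are proved for the edges
    on an actual path. *)
Definition reach w e : Prop :=
  exists cs, exists2 v, is_path w cs v & e \in run (base w) cs.

Lemma reach_run w cs v e : is_path w cs v -> e \in run (base w) cs -> reach w e.
Proof. by move=> H He; exists cs, v. Qed.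

Lemma reach_base w e : e \in base w -> reach w e.
Proof. by move=> He; exists [::], w. Qed.

Lemma base_run_good w cs v : is_path w cs v -> good (size v) (run (base w) cs).
Proof. by move=> H; apply: run_good H (base_good _). Qed.

Lemma sub_run w cs v ds y : is_path w cs v -> is_path v ds y ->
  map (sub w cs) (run (base v) ds) = run (base w) (cs ++ ds).
Proof.
by move=> H1 H2; rewrite run_cat -(subst_run (base_run_good H1) H2).
Qed.

Lemma sub_cat w cs v ds y e : is_path w cs v -> is_path v ds y -> reach y e ->
  sub w (cs ++ ds) e = sub w cs (sub v ds e).
Proof.
move=> H1 H2 [es [z H3 He]].
have : map (sub w (cs ++ ds)) (run (base y) es) =
       map (fun e => sub w cs (sub v ds e)) (run (base y) es).
  rewrite (sub_run (is_path_catI H1 H2) H3) -catA map_comp (sub_run H2 H3).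
  by rewrite (sub_run H1 (is_path_catI H2 H3)).
by move/eq_in_map; apply.
Qed.

Lemma sub_dequiv w v cs ds : cs ~[w, v] ds -> sub w cs =1 sub w ds.
Proof. by move=> H e; rewrite /sub (run_dequiv H (base_good _)). Qed.

Lemma sub_nil w e : reach w e -> sub w [::] e = e.
Proof.
case=> cs [v H He]; have := sub_run (erefl w : is_path w [::] w) H.
by rewrite -[RHS]map_id => /eq_in_map; apply.
Qed.

Lemma reach_sub w cs v e : is_path w cs v -> reach v e -> reach w (sub w cs e).
Proof.
move=> H1 [ds [y H2 He]]; apply: (reach_run (is_path_catI H1 H2)).
by rewrite -(sub_run H1 H2) map_f.
Qed.

Lemma sub_pinvK w cs v e : is_path w cs v -> reach v e ->
  sub v (pinv cs) (sub w cs e) = e.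
Proof.
move=> H He; rewrite -(sub_cat (is_path_pinv H) H He) (sub_dequiv (dequiv_pinvl H)).
exact: sub_nil.
Qed.

Lemma sub_pinvVK w cs v e : is_path w cs v -> reach w e ->
  sub w cs (sub v (pinv cs) e) = e.
Proof. by move=> /is_path_pinv H He; have := sub_pinvK H He; rewrite pinvK. Qed.

Lemma sub_inj w cs v e e' : is_path w cs v -> reach v e -> reach v e' ->
  sub w cs e = sub w cs e' -> e = e'.
Proof. by move=> H He He' E; rewrite -(sub_pinvK H He) E sub_pinvK. Qed.

(** * Diagrams that avoid an edge *)

Fixpoint avoid e L cs : Prop :=
  if cs is c :: cs' then
    e \notin take (sz (c_rel c) (c_dir c)) (drop (size (c_pre c)) L) /\ avoid e (actc L c) cs'
  else True.

(** A base edge consumed by a reduced sequence never returns, since all edges created are of the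
    form [New]. *)
Lemma newonly_avoid j x L cs y : is_path x cs y -> good (size x) L -> newonly L cs ->
  Base j \in run L cs -> avoid (Base j) L cs.
Proof.
have notin cs' : forall L', newonly L' cs' -> Base j \notin L' -> Base j \notin run L' cs'.
  elim: cs' => [|c cs' IH] L' //= [[A [s [B [E sA ss Hatt]]]] Hn] Hj; apply: IH => //.
  move: Hj; rewrite E actcE // Hatt !mem_cat !negb_or => /and3P[-> _ ->]; rewrite andbT /=.
  by apply/negP => /mem_NewsP[].
elim: cs x L => [|c cs IH] x L //= [E0 Hp] HL [Hs Hn] Hj.
rewrite -E0 in HL; split; last by apply: IH Hn Hj; [exact: Hp|exact: actc_good].
apply/negP => Hj'; case: Hs => A [s [B [E sA ss Hatt]]].
move: Hj'; rewrite E -sA -ss drop_size_cat // take_size_cat // => Hjs.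
have := good_uniq HL; rewrite E !cat_uniq => /and3P[_ HA /and3P[_ HB _]].
apply/negP: Hj; apply: notin => //; rewrite E actcE // Hatt !mem_cat !negb_or.
apply/and3P; split.
- by apply: contra HA => HjA; apply/hasP; exists (Base j); rewrite // mem_cat Hjs.
- by apply/negP => /mem_NewsP[].
- by apply: contra HB => HjB; apply/hasP; exists (Base j).
Qed.

Lemma avoid_sub w cs v ds es y e : is_path w cs v -> is_path v (ds ++ es) y ->
  reach v e -> avoid e (run (base v) ds) es -> avoid (sub w cs e) (run (base w) (cs ++ ds)) es.
Proof.
move=> H + He; elim: es ds => //= c es IH ds Hp [H1 H2]; split; last first.
  by rewrite -cat_rcons in Hp; have := IH _ Hp; rewrite -cats1 !catA !run_cat; apply.
have [y' Hd _] : exists2 y', is_path v ds y' & is_path y' (c :: es) y by apply/is_path_cat.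
rewrite -(sub_run H Hd) -map_drop -map_take; apply: contra H1 => /mapP[e' He' Ee].
suff -> : e = e' by [].
apply: sub_inj H He _ Ee; apply: reach_run Hd _.
by move: He' => /mem_take/mem_drop.
Qed.

(** The analogue of geodesics in a tree: translate the first path to the base and join it to the
    second by a reduced sequence, which by [newonly_avoid] leaves the common edges alone. *)
Lemma avoid_common w cs v cs' v' : is_path w cs v -> is_path w cs' v' ->
  exists ds, [/\ is_path v ds v', run (run (base w) cs) ds = run (base w) cs' &
    forall e, e \in run (base w) cs -> e \in run (base w) cs' -> avoid e (run (base w) cs) ds].
Proof.
move=> H H'; have Hd := is_path_catI (is_path_pinv H) H'.
have [ds [Hn Hp He]] := newonly_exists Hd.
have Er : run (base w) (cs ++ ds) = run (base w) cs'.
  apply: (@run_dequiv w v') (base_good _).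
  apply: dequiv_trans (dequiv_catl H (dequiv_sym He)) _.
  by rewrite catA; apply: (dequiv_catr H' (dequiv_pinvr H)).
exists ds; split=> //; first by rewrite -run_cat.
move=> e; rewrite -Er -(sub_run H Hp) -[cs in X in X -> _]cats0.
rewrite -(sub_run H (erefl v : is_path v [::] v)) /=.
move=> /mapP[e1 H1 ->] /mapP[e2 H2 E].
have e12 : e1 = e2.
  by apply: sub_inj H _ _ E; [exact: reach_base|exact: reach_run Hp H2].
subst e2; case/mapP: (H1) => j _ Ej; rewrite Ej in H2 *.
have Ha := newonly_avoid Hp (base_good _) Hn H2.
have := @avoid_sub w cs v [::] ds v' (Base j) H Hp; rewrite cats0; apply=> //.
by rewrite -Ej; apply: reach_base.
Qed.

(** Each cell lies wholly to the left or wholly to the right of the avoided edge, so the diagram is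
    a sum of two with that edge and its label between them. *)
Lemma split_avoid cs v v' v1 t v2 A e B : is_path v cs v' -> v = v1 ++ t :: v2 ->
  size A = size v1 -> good (size v) (A ++ e :: B) -> avoid e (A ++ e :: B) cs ->
  exists csA csB v1' v2', [/\ is_path v1 csA v1' /\ is_path v2 csB v2',
    v' = v1' ++ t :: v2', run (A ++ e :: B) cs = run A csA ++ e :: run B csB,
    size (run A csA) = size v1' &
    forall e', avoid e' (A ++ e :: B) cs -> avoid e' B csB].
Proof.
elim: cs v v1 v2 A B => [|c cs IH] v v1 v2 A B /=.
  by move=> <- -> sA _ _; exists [::], [::], v1, v2.
move=> [E0 Hp] Ev sA HL [Hav1 Hav2].
have HL1 : good (size (csrc c)) (A ++ e :: B) by rewrite E0.
have HL2 := actc_good HL1.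
have [HA /(@good_cat _ [:: e])[_ HB]] := good_cat HL.
have sL : size (A ++ e :: B) = size v by case: HL.
move: Hav1 Hav2 HL2 Hp; case: c E0 {HL1} => p i b q E0 /= Hav1 Hav2 HL2 Hp.
rewrite /csrc /= Ev in E0.
have [H|H] := leqP (size p + sz i b) (size v1).
  have [m Em Eq] : exists2 m, v1 = (p ++ side i b) ++ m & q = m ++ t :: v2.
    by apply: cat_split; rewrite -?catA // size_cat.
  have HA' : good (size (csrc (Cell p i b m))) A by rewrite /csrc /= catA -Em -sA.
  have [A0 s M EA sA0 Hs sM EA'] := cell_splitP HA'; have [ss _ _] := Hs.
  have EL : actc (A ++ e :: B) (Cell p i b q) = actc A (Cell p i b m) ++ e :: B.
    by rewrite EA' EA -!catA actcE //= -?catA.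
  rewrite EL in Hav2 HL2 *.
  have [||csA [csB [v1' [v2' [[H1 H2] Ev' Er sA' Hav]]]]] :=
    IH _ (p ++ side i (~~ b) ++ m) v2 _ _ Hp _ _ HL2 Hav2.
  - by rewrite /ctgt /= Eq -!catA.
  - by case: (actc_good HA').
  exists (Cell p i b m :: csA), csB, v1', v2'; split=> //=; last by move=> e' [_ /Hav].
  by split=> //; split=> //; rewrite /csrc /= Em catA.
have [H'|H'] := leqP (size p) (size v1).
  (* The cell would cover the position of [e]. *)
  exfalso; move/negP: Hav1; apply.
  have En : nth e (take (sz i b) (drop (size p) (A ++ e :: B))) (size v1 - size p) = e.
    rewrite nth_take; last by lia.
    by rewrite nth_drop subnKC // -sA nth_cat ltnn subnn.
  rewrite -[X in X \in _]En; apply: mem_nth; rewrite size_take size_drop sL Ev size_cat /=.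
  by case: ifP => _; lia.
have [m Em Eq] : exists2 m, p = (v1 ++ [:: t]) ++ m & v2 = m ++ side i b ++ q.
  by apply: cat_split; rewrite -?catA // size_cat /=; lia.
have sp : size p = size A + (size m).+1 by rewrite Em !size_cat /= sA; lia.
have HB' : good (size (csrc (Cell m i b q))) B.
  rewrite /csrc /= -Eq; have <- // : size B = size v2.
  by move: sL; rewrite Ev !size_cat /= sA; lia.
have [B0 s M EB sB0 Hs sM EB'] := cell_splitP HB'; have [ss _ _] := Hs.
have EL : actc (A ++ e :: B) (Cell p i b q) = A ++ e :: actc B (Cell m i b q).
  rewrite EB' EB; have -> X : A ++ e :: B0 ++ X = (A ++ e :: B0) ++ X by rewrite -catA.
  by rewrite actcE //= ?sp ?size_cat /= ?sB0 // -catA.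
rewrite EL in Hav2 HL2 *.
have [|csA [csB [v1' [v2' [[H1 H2] Ev' Er sA' Hav]]]]] :=
  IH _ v1 (m ++ side i (~~ b) ++ q) _ _ Hp _ sA HL2 Hav2.
  by rewrite /ctgt /= Em -!catA.
have H2' : is_path v2 (Cell m i b q :: csB) v2' by split=> //; rewrite /csrc /= Eq.
exists csA, (Cell m i b q :: csB), v1', v2'; split; [by []|by []|by []|by []|].
move=> e' [He' /Hav Hav']; split=> //; apply: contra He'.
rewrite sp drop_cat; case: ltnP => [|_]; first by lia.
by have -> : size A + (size m).+1 - size A = (size m).+1 by lia.
Qed.

Lemma run_liftl p x cs y A B : is_path x cs y -> good (size x) B -> size A = size p ->
  run (A ++ B) (map (clift p [::]) cs) = A ++ run B cs.
Proof.
move=> + + sA; elim: cs x B => [|c cs IH] x B //= [<- Hp] HB.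
rewrite -(IH _ _ Hp) //; last exact: actc_good.
have [B0 s M EB sB0 Hs sM ->] := cell_splitP HB; have [ss _ _] := Hs.
congr (run _ _); rewrite EB.
have -> : A ++ B0 ++ s ++ M = (A ++ B0) ++ s ++ M by rewrite catA.
by rewrite actcE //= -?catA // !size_cat sA sB0.
Qed.

(* Three paths with the same label [v1 t z t' v3] carrying at the marked places
   the pairs of edges (p, q), (q, r) and (p, r) force [z t' z = z]. *)
Lemma idempotent_of_edges w cs1 cs2 cs3 v1 t z t' v3 p q r A1 Z1 B1 A2 Z2 B2 A3 Z3 B3 :
  let v := v1 ++ t :: z ++ t' :: v3 in
  is_path w cs1 v -> is_path w cs2 v -> is_path w cs3 v ->
  run (base w) cs1 = A1 ++ p :: Z1 ++ q :: B1 ->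
  run (base w) cs2 = A2 ++ q :: Z2 ++ r :: B2 ->
  run (base w) cs3 = A3 ++ p :: Z3 ++ r :: B3 ->
  size A1 = size v1 -> size A2 = size v1 -> size A3 = size v1 ->
  size Z1 = size z -> size Z2 = size z -> size Z3 = size z ->
  has_idempotent lhs rhs.
Proof.
move=> v H1 H2 H3 E1 E2 E3 sA1 sA2 sA3 sZ1 sZ2 sZ3.
have [ds [Hd Er Hav]] := avoid_common H1 H2.
have Hq : avoid q (run (base w) cs1) ds.
  by apply: Hav; rewrite ?E1 ?E2 !(mem_cat, inE) eqxx ?orbT.
have E1' : run (base w) cs1 = (A1 ++ p :: Z1) ++ q :: B1 by rewrite E1 -catA.
have G1 := base_run_good H1; have G2 := base_run_good H2.
have G3 := base_run_good H3.
rewrite E1' in Hq Er G1; have sAZ : size (A1 ++ p :: Z1) = size (v1 ++ t :: z).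
  by rewrite !size_cat /= sA1 sZ1.
have Ev : v = (v1 ++ t :: z) ++ t' :: v3 by rewrite /v -catA.
have [csA [csB [v1' [v2' [[HA HB] Ev' Er' sA' _]]]]] := split_avoid Hd Ev sAZ G1 Hq.
(* Cut at [q]: comparing lengths gives [t' = t], and [csB] is a diagram from [v3] to [z ++ t :: v3]
   that carries [B1] to [Z2 ++ r :: B2]. *)
have [EA EB] : A2 = run (A1 ++ p :: Z1) csA /\ Z2 ++ r :: B2 = run B1 csB.
  by apply: (@uniq_cat_inj _ _ _ _ _ q); [rewrite -E2 (good_uniq G2)|rewrite -Er' Er E2].
have [_ [Et Ev2]] : v1 = v1' /\ t :: z ++ t' :: v3 = t' :: v2'.
  by apply: cat_inj_size; rewrite // -sA' -EA.
rewrite -Ev2 in HB; subst t'.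
have GB1 : good (size v3) B1.
  have [_ /(@good_cat _ [:: q])[_]] := good_cat G1.
  have [sL _ _] := G1; move: sL; rewrite /v !size_cat /= !size_cat /= sA1 sZ1 => sL.
  by have -> : size B1 = size v3 by lia.
(* Applying [csB] to the right of [q] after [cs1] yields one path through [p], [q] and [r]. *)
pose v4 := v1 ++ t :: z ++ t :: z ++ t :: v3.
pose cs4 := cs1 ++ map (clift (v1 ++ t :: z ++ [:: t]) [::]) csB.
have H4 : is_path w cs4 v4.
  apply: is_path_catI H1 _; have := is_path_liftl (v1 ++ t :: z ++ [:: t]) HB.
  by rewrite /v /v4 -!catA /= -!catA.
have E4 : run (base w) cs4 = A1 ++ p :: Z1 ++ q :: Z2 ++ r :: B2.
  rewrite run_cat E1.
  have -> : A1 ++ p :: Z1 ++ q :: B1 = (A1 ++ p :: Z1 ++ [:: q]) ++ B1 by rewrite -!catA /= -catA.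
  rewrite (run_liftl HB GB1) -?EB; first by rewrite -!catA /= -catA.
  by rewrite !size_cat /= !size_cat sA1 sZ1.
have G4 := base_run_good H4.
(* This path and that of [cs3] share [p] and [r]; cutting at both leaves a diagram from
   [z ++ t :: z] to [z]. *)
have [ds4 [Hd4 Er4 Hav4]] := avoid_common H4 H3.
have Hp4 : avoid p (run (base w) cs4) ds4.
  by apply: Hav4; rewrite ?E4 ?E3 !(mem_cat, inE) eqxx ?orbT.
have Hr4 : avoid r (run (base w) cs4) ds4.
  by apply: Hav4; rewrite ?E4 ?E3 !(mem_cat, inE) eqxx ?orbT.
rewrite E4 in Hp4 Hr4 Er4 G4.
have [csA4 [csB4 [v14 [v24 [[HA4 HB4] Ev4 Er4' sA4 Hav4']]]]] :=
  split_avoid Hd4 (erefl v4) sA1 G4 Hp4.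
have [EA4 EB4] : A3 = run A1 csA4 /\ Z3 ++ r :: B3 = run (Z1 ++ q :: Z2 ++ r :: B2) csB4.
  by apply: (@uniq_cat_inj _ _ _ _ _ p); [rewrite -E3 (good_uniq G3)|rewrite -Er4' Er4 E3].
have [_ [Ev24]] : v1 = v14 /\ t :: z ++ t :: v3 = t :: v24.
  by apply: cat_inj_size; rewrite // -sA4 -EA4.
have {}Hr4 := Hav4' _ Hr4.
have EZ : Z1 ++ q :: Z2 ++ r :: B2 = (Z1 ++ q :: Z2) ++ r :: B2 by rewrite -catA.
have Ez : z ++ t :: z ++ t :: v3 = (z ++ t :: z) ++ t :: v3 by rewrite -catA.
have sZZ : size (Z1 ++ q :: Z2) = size (z ++ t :: z) by rewrite !size_cat /= sZ1 sZ2.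
rewrite EZ in Hr4 EB4 G4.
have G5 : good (size (z ++ t :: z ++ t :: v3)) ((Z1 ++ q :: Z2) ++ r :: B2).
  have [_ /(@good_cat _ [:: p])[_]] := good_cat G4.
  have [+ _ _] := G4; rewrite /v4 size_cat [X in _ = X]size_cat sA1 => /addnI /= [<-] //.
have [csA5 [csB5 [v15 [v25 [[HA5 HB5] Ev5 Er5 sA5 _]]]]] := split_avoid HB4 Ez sZZ G5 Hr4.
have U3 : uniq (Z3 ++ r :: B3).
  have := good_uniq G3; rewrite E3 cat_uniq => /and3P[_ _ /=].
  by case/andP.
have [EZ3 _] : Z3 = run (Z1 ++ q :: Z2) csA5 /\ B3 = run B2 csB5.
  by apply: uniq_cat_inj U3 _; rewrite EB4.
have [Ez5 _] : z = v15 /\ t :: v3 = t :: v25.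
  by apply: cat_inj_size; rewrite ?Ev24 // -sA5 -EZ3.
rewrite -Ez5 in HA5; exists (z ++ [:: t]); split; first by case: (z).
by have := sg_eq_catr [:: t] (path_sg_eq HA5); rewrite -!catA.
Qed.

(** * Axes *)

Section Axis.
Lemma is_path_take x cs y j : is_path x cs y -> exists y', is_path x (take j cs) y'.
Proof.
by rewrite -{1}(cat_take_drop j cs) => /is_path_cat[y' H _]; exists y'.
Qed.

Definition edges_on w cs : seq edge :=
  flatten [seq run (base w) (take j cs) | j <- iota 0 (size cs).+1].

Lemma edges_onP w cs e :
  reflect (exists j, e \in run (base w) (take j cs)) (e \in edges_on w cs).
Proof.
apply: (iffP flattenP) => [[L /mapP[j _ ->] He]|[j He]]; first by exists j.
have [jc|/ltnW/take_oversize Et] := leqP j (size cs).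
  by exists (run (base w) (take j cs)); rewrite ?map_f ?mem_iota.
exists (run (base w) cs); last by rewrite -Et.
by apply/mapP; exists (size cs); [rewrite mem_iota ltnSn|rewrite take_size].
Qed.

Lemma edges_on_reach w cs v e : is_path w cs v -> e \in edges_on w cs -> reach w e.
Proof. by move=> H /edges_onP[j]; have [y Hj] := is_path_take j H; apply: reach_run Hj. Qed.

Definition pow cs n : seq cell := iter n (cat cs) [::].

Variable w : seq S.
Local Notation path_ww b := (is_path w b w).

Lemma pow_path cs n : path_ww cs -> path_ww (pow cs n).
Proof. by move=> H; elim: n => // n IH; apply: is_path_catI H IH. Qed.

Lemma reach_iter cs n e : path_ww cs -> reach w e -> reach w (iter n (sub w cs) e).
Proof. by move=> H He; elim: n => //= n IH; apply: reach_sub H IH. Qed.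

Lemma sub_pow cs n e : path_ww cs -> reach w e -> sub w (pow cs n) e = iter n (sub w cs) e.
Proof.
move=> H He; elim: n => [|n IH]; first by rewrite sub_nil.
by rewrite (sub_cat H (pow_path n H) He) IH.
Qed.

Lemma run_pow_cat cs n ds v : path_ww cs -> is_path w ds v ->
  run (base w) (pow cs n ++ ds) = map (iter n (sub w cs)) (run (base w) ds).
Proof.
move=> H Hd; rewrite -(sub_run (pow_path n H) Hd); apply/eq_in_map => e He.
by rewrite sub_pow //; apply: reach_run Hd He.
Qed.

Lemma run_pow cs n : path_ww cs -> run (base w) (pow cs n) = map (iter n (sub w cs)) (base w).
Proof. by move=> H; rewrite -(@run_pow_cat _ _ [::] w) // cats0. Qed.

Lemma iter_sub_inj cs n e e' : path_ww cs -> reach w e -> reach w e' ->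
  iter n (sub w cs) e = iter n (sub w cs) e' -> e = e'.
Proof.
move=> H He He' E; apply: (sub_inj (pow_path n H)) => //.
by rewrite !sub_pow.
Qed.

Definition nonperiodic cs e := forall k, iter k (sub w cs) e = e -> k = 0.

Lemma nonperiodic_iter cs e k l : path_ww cs -> reach w e -> nonperiodic cs e ->
  iter k (sub w cs) e = iter l (sub w cs) e -> k = l.
Proof.
move=> H He Hn; wlog kl : k l / k <= l => [Hw E|].
  by case/orP: (leq_total k l) => kl; [exact: Hw|exact/esym/(Hw l k)].
rewrite -(subnKC kl) iterD => /(iter_sub_inj H He)/esym/Hn -> //; first by rewrite addn0.
exact: reach_iter.
Qed.

(** The forward orbit of [e] meets each element of the finite set [D] at most once. *)
Lemma nonperiodic_leave cs e (D : seq edge) : path_ww cs -> reach w e -> nonperiodic cs e ->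
  exists m, forall k, m <= k -> iter k (sub w cs) e \notin D.
Proof.
move=> H He Hn; elim: D => [|d D [m Hm]]; first by exists 0.
have [[k0 Ek0]|Hk] := classic (exists k, iter k (sub w cs) e = d).
  exists (maxn m k0.+1) => k; rewrite geq_max => /andP[mk k0k]; rewrite inE negb_or Hm // andbT.
  by apply/eqP => Ek; have := nonperiodic_iter H He Hn (etrans Ek (esym Ek0)); lia.
exists m => k mk; rewrite inE negb_or Hm // andbT; apply/eqP => E.
by apply: Hk; exists k.
Qed.

Lemma nonperiodic_enter cs e (D : seq edge) : path_ww cs -> nonperiodic cs e ->
  exists m, forall k d, m <= k -> d \in D -> iter k (sub w cs) d <> e.
Proof.
move=> H Hn; elim: D => [|d D [m Hm]]; first by exists 0.
have [[k0 Ek0]|Hk] := classic (exists k, iter k (sub w cs) d = e).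
  exists (maxn m k0.+1) => k d'; rewrite geq_max => /andP[mk k0k]; rewrite inE.
  case/predU1P=> [->|/Hm]; last by apply.
  have -> : k = (k - k0) + k0 by lia.
  by rewrite iterD Ek0 => /Hn; lia.
exists m => k d' mk; rewrite inE => /predU1P[->|/Hm]; last by apply.
by move=> E; apply: Hk; exists k.
Qed.

(* The edges on the axis of [g]: those that every sequence of cells from far in the past
   of [g] to far in its future must cross (everything being translated so that the
   sequence starts at the base). *)
Definition axis g e := [/\ reach w e, nonperiodic g e &
  forall m, exists k k', [/\ m <= k, m <= k' &
    forall cs, path_ww cs -> run (base w) cs = run (base w) (pow g (k + k')) ->
      iter k (sub w g) e \in edges_on w cs]].

(** The axis does not depend on the starting path: ds cs ds^-1 must cross g^k e. For large exponents
    the crossing is neither in ds ([nonperiodic_leave]) nor in the translate of ds^-1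
    ([nonperiodic_enter]), so it is in cs. *)
Lemma axis_crossing g e ds v m : path_ww g -> axis g e -> is_path w ds v ->
  exists k k', [/\ m <= k, m <= k' & forall cs, is_path v cs v ->
    run (base w) (ds ++ cs) = map (iter (k + k') (sub w g)) (run (base w) ds) ->
    exists j, iter k (sub w g) e \in run (base w) (ds ++ take j cs)].
Proof.
move=> Hg [He Hn Hax] Hd; have Hd' := is_path_pinv Hd.
have [m1 H1] := nonperiodic_leave (edges_on w ds) Hg He Hn.
have [m2 H2] := nonperiodic_enter (edges_on w (ds ++ pinv ds)) Hg Hn.
have [k [k' [mk mk' Hk]]] := Hax (maxn m (maxn m1 m2)).
move: mk mk'; rewrite !geq_max => /and3P[mk m1k m2k] /and3P[mk' m1k' m2k'].
exists k, k'; split=> // cs Hc Er.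
have Er' : run (base w) (ds ++ cs) = run (base w) (pow g (k + k') ++ ds).
  by rewrite Er (run_pow_cat _ Hg Hd).
have Hp := pow_path (k + k') Hg.
have /edges_onP[j] : iter k (sub w g) e \in edges_on w (ds ++ cs ++ pinv ds).
  apply: Hk; first exact: is_path_catI Hd (is_path_catI Hc Hd').
  rewrite catA run_cat Er' -run_cat -catA.
  have := run_dequiv (dequiv_catl Hp (dequiv_pinvr Hd)) (base_good _).
  by rewrite cats0.
rewrite take_cat; case: ltnP => [jd|_].
  by move=> Hj; case/negP: (H1 k m1k); apply/edges_onP; exists j.
rewrite take_cat; case: ltnP => [jc Hj|_]; first by exists (j - size ds).
move: (j - _ - _) => {}j; rewrite catA run_cat Er' -run_cat -catA.
have [y Hy] := is_path_take j Hd'.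
rewrite (run_pow_cat _ Hg (is_path_catI Hd Hy)) => /mapP[d Hdd E]; exfalso.
have Hrd := reach_run (is_path_catI Hd Hy) Hdd.
rewrite iterD in E; have Ed := iter_sub_inj Hg He (reach_iter k' Hg Hrd) E.
apply: (H2 k' d m2k') => //; apply/edges_onP; exists (size ds + j).
by rewrite take_cat ltnNge leq_addr /= addKn.
Qed.

Lemma sub_iter_comm h g g' n e : path_ww h -> path_ww g -> path_ww g' ->
  (forall d, reach w d -> sub w h (sub w g d) = sub w g' (sub w h d)) -> reach w e ->
  sub w h (iter n (sub w g) e) = iter n (sub w g') (sub w h e).
Proof.
move=> Hh Hg Hg' E He; elim: n => //= n IH; rewrite E ?IH //; exact: reach_iter.
Qed.

(** Apply [axis_crossing] to the path obtained from h^-1, then translate by h. *)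
Lemma axis_conj h g g' e : path_ww h -> path_ww g -> path_ww g' ->
  (forall d, reach w d -> sub w h (sub w g d) = sub w g' (sub w h d)) ->
  axis g e -> axis g' (sub w h e).
Proof.
move=> Hh Hg Hg' E Ha; have [He Hn _] := Ha; have Hh' := is_path_pinv Hh.
have E' d : reach w d -> sub w (pinv h) (sub w g' d) = sub w g (sub w (pinv h) d).
  move=> Hd; have Hd' := reach_sub Hh' Hd.
  rewrite -{1}(sub_pinvVK Hh Hd) -E // sub_pinvK //.
  exact: reach_sub Hg Hd'.
split; first exact: reach_sub Hh He.
- move=> k; rewrite -(sub_iter_comm k Hh Hg Hg' E He) => Ek; apply: Hn.
  by apply: (sub_inj Hh) Ek => //; apply: reach_iter.
move=> m; have [k [k' [mk mk' Hk]]] := axis_crossing m Hg Ha Hh'.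
exists k, k'; split=> // cs Hc Er.
have [|j] := Hk cs Hc.
  rewrite -(sub_run Hh' Hc) Er run_pow // -{2}[pinv h]cats0.
  rewrite -(sub_run Hh' (erefl w : is_path w [::] w)) /=.
  rewrite -[LHS]map_comp -[RHS]map_comp.
  apply/eq_in_map => d /= /reach_base Hd.
  exact: sub_iter_comm.
have [y Hy] := is_path_take j Hc; rewrite -(sub_run Hh' Hy) => /mapP[d Hd Ed].
apply/edges_onP; exists j; rewrite -(sub_iter_comm k Hh Hg Hg' E He) Ed sub_pinvVK //.
exact: reach_run Hy Hd.
Qed.

Lemma edges_on_pow g n e : path_ww g -> e \in edges_on w (pow g n) ->
  exists l, exists2 x, l <= n /\ x \in edges_on w g & e = iter l (sub w g) x.
Proof.
move=> Hg; elim: n e => [|n IH] e /edges_onP[j] /=.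
  by move=> He; exists 0, e => //; split=> //; apply/edges_onP; exists 0; rewrite take0.
rewrite take_cat; case: ltnP => [_ He|_].
  by exists 0, e => //; split=> //; apply/edges_onP; exists j.
have [y Hy] := is_path_take (j - size g) (pow_path n Hg).
rewrite -(sub_run Hg Hy) => /mapP[d Hd ->].
have [|l [x [ln Hx] ->]] := IH d; first by apply/edges_onP; exists (j - size g).
by exists l.+1, x.
Qed.

(** The power of [g] itself is one of the sequences that must cross the axis, and its edges are
    translates of those on [g]. *)
Lemma axis_fin g e : path_ww g -> axis g e ->
  exists (x : edge) k l, x \in edges_on w g /\ iter k (sub w g) e = iter l (sub w g) x.
Proof.
move=> Hg [_ _ /(_ 0)[k [k' [_ _ Hk]]]].
have [|l [x [_ Hx] E]] := edges_on_pow Hg (Hk _ (pow_path (k + k') Hg) _) => //.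
by exists x, k, l.
Qed.

End Axis.

Local Notation path_ww w g := (is_path w g w).

(** * Existence of an axis *)

Inductive anc L : edge -> Prop :=
| anc_mem e : e \in L -> anc L e
| anc_New i b s j e : anc L (New i b s j) -> e \in s -> anc L e.

(** A cell adds edges whose ancestors come from the segment it is attached to or, when it cancels,
    edges that were ancestors already. So every ancestor of the final path has been crossed. *)
Lemma anc_edges_on w cs v e : is_path w cs v -> anc (run (base w) cs) e -> e \in edges_on w cs.
Proof.
elim/last_ind: cs v e => [|cs d IH] v e Hp.
  move=> Ha; apply/edges_onP; exists 0; move: Ha => /=.
  by elim=> // i b s j e' _ /mapP[].
move: Hp; rewrite -cats1 run_cat => /is_path_cat[v0 Hp /= [E0 _]].
have := base_run_good Hp; rewrite -E0 => /cell_splitP[A s B EL sA Hs sB ->] Ha.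
have [] : anc (run (base w) cs) e \/
    e \in A ++ attach (c_rel d) (c_dir d) s ++ B; last first.
- move=> He; apply/edges_onP; exists (size (cs ++ [:: d])).
  by rewrite take_size run_cat /= EL actcE //; case: Hs.
- move=> /(IH _ _ Hp)/edges_onP[j Hj]; apply/edges_onP.
  have [jc|/ltnW/take_oversize Et] := leqP j (size cs).
    by exists j; rewrite takel_cat.
  by exists (size cs); rewrite take_size_cat // -Et.
elim: Ha => [e' He'|i b s' j e' _ IHa He']; [by right|left].
case: IHa => [Ha|]; first exact: anc_New Ha He'.
have inL e0 : e0 \in A ++ s ++ B -> anc (run (base w) cs) e0.
  by rewrite -EL; apply: anc_mem.
have inN : New i b s' j \in A ++ s ++ B -> anc (run (base w) cs) e'.
  by move=> /inL H; apply: anc_New H He'.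
rewrite !mem_cat => /or3P[HA|Hs'|HB].
- by apply: inN; rewrite mem_cat HA.
- case: (attachP (c_rel d) (c_dir d) s) Hs' => [s'' Es|_] Hs'.
    have [L EN] := News_head (c_rel d) (~~ c_dir d) s''.
    apply: anc_New He'; apply: (anc_New (i := c_rel d) (b := ~~ c_dir d) (j := 0)) Hs'.
    by apply: inL; rewrite !mem_cat Es EN mem_head orbT.
  have /mem_NewsP[j' [_ _ Es _] _] := Hs'.
  by apply: inL; rewrite !mem_cat -Es He' orbT.
- by apply: inN; rewrite !mem_cat HB !orbT.
Qed.

Fixpoint depth e : nat :=
  if e is New _ _ s _ then (foldr maxn 0 (map depth s)).+1 else 0.

Lemma anc_depth L e d : anc L e -> 0 < d <= depth e -> exists2 e', anc L e' & depth e' = d.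
Proof.
elim/edge_induction: e => [j|i b s j IH] Ha /andP[d0] /=; first by lia.
rewrite leq_eqVlt => /predU1P[->|]; first by exists (New i b s j).
rewrite ltnS => Hd.
have [e' He' Hd'] : exists2 e', e' \in s & d <= depth e'.
  elim: s Hd {IH Ha} => [|e' s IHs] /=; first by lia.
  rewrite leq_max => /orP[He'|/IHs[e'' He'' Hd'']].
    by exists e'; rewrite ?mem_head.
  by exists e''; rewrite // inE He'' orbT.
by apply: (IH e') => //; [exact: anc_New Ha He'|rewrite d0].
Qed.

(** Every depth from 1 to [depth e] is attained by an ancestor, by [anc_depth]. *)
Lemma anc_depth_bound L e (l : seq edge) :
  (forall e', anc L e' -> e' \in l) -> anc L e -> depth e <= size l.
Proof.
move=> Hl Ha; have <- : size (iota 1 (depth e)) = depth e by rewrite size_iota.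
rewrite -(size_map depth l); apply: uniq_leq_size (iota_uniq _ _) _ => d.
rewrite mem_iota add1n ltnS => Hd; have [e' He' <-] := anc_depth Ha Hd.
exact/map_f/Hl.
Qed.

(** As [I] may be infinite, finiteness at bounded depth is stated for relations from a finite list
    [J]. *)
Inductive typed (J : seq I) n : edge -> Prop :=
| typed_Base j : j < n -> typed J n (Base j)
| typed_New i b s j : List.In i J -> size s = sz i b -> j < sz i (~~ b) ->
    (forall e, e \in s -> typed J n e) -> typed J n (New i b s j).

Lemma typed_run J n cs : forall L x y, is_path x cs y -> good (size x) L ->
  (forall c, List.In c cs -> List.In (c_rel c) J) ->
  (forall e, e \in L -> typed J n e) -> forall e, e \in run L cs -> typed J n e.
Proof.
elim: cs => [|c cs IH] L x y //= [E0 Hp] HL HJ Ht; rewrite -E0 in HL.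
apply: IH Hp (actc_good HL) _ _; first by move=> c' Hc'; apply: HJ; right.
have [A s B EL sA Hs sB ->] := cell_splitP HL; have [ss _ _] := Hs.
have {}Ht e : e \in A ++ s ++ B -> typed J n e by rewrite -EL; apply: Ht.
move=> e; rewrite !mem_cat => /or3P[eA|He|eB].
- by apply: Ht; rewrite mem_cat eA.
- case: (attachP (c_rel c) (c_dir c) s) He => [s' Es|_].
    have [L' EN] := News_head (c_rel c) (~~ c_dir c) s'.
    have : typed J n (New (c_rel c) (~~ c_dir c) s' 0).
      by apply: Ht; rewrite !mem_cat Es EN mem_head orbT.
    by move=> H; inversion H; auto.
  move=> /mem_NewsP[j -> jk]; constructor=> //; first by apply: HJ; left.
  by move=> e' He'; apply: Ht; rewrite !mem_cat He' orbT.
- by apply: Ht; rewrite !mem_cat eB !orbT.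
Qed.

Fixpoint seqs (k : nat) (U : seq edge) : seq (seq edge) :=
  if k is k'.+1 then [seq e :: s | e <- U, s <- seqs k' U] else [:: [::]].

Lemma mem_seqs (U : seq edge) s : {subset s <= U} -> s \in seqs (size s) U.
Proof.
elim: s => [|e s IH] //= H; apply: allpairs_f; first exact/H/mem_head.
by apply: IH => e' He'; apply: H; rewrite inE He' orbT.
Qed.

Lemma typed_finite J n d : exists U : seq edge,
  forall e, typed J n e -> depth e <= d -> e \in U.
Proof.
elim: d => [|d [U HU]].
  by exists [seq Base j | j <- iota 0 n] => e [j jn|//] _; rewrite map_f ?mem_iota.
have [V HV] : exists V : seq edge, forall i b s j, List.In i J -> size s = sz i b ->
    j < sz i (~~ b) -> {subset s <= U} -> New i b s j \in V.
  elim: J {HU} => [|i J [V HV]]; first by exists [::].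
  pose N b := [seq New i b s j | s <- seqs (sz i b) U, j <- iota 0 (sz i (~~ b))].
  exists (N true ++ N false ++ V) => i' b s j [<-|Hi] ss js sU; last first.
    by rewrite !mem_cat (HV i' b s j) ?orbT.
  have : New i b s j \in N b.
    by apply: allpairs_f; rewrite ?mem_iota // -ss mem_seqs.
  by rewrite !mem_cat; case: b {ss js} => ->; rewrite ?orbT.
exists ([seq Base j | j <- iota 0 n] ++ V) => e [j jn|i b s j Hi ss js Hs] /=.
  by rewrite mem_cat map_f ?mem_iota.
rewrite ltnS => Hd; rewrite mem_cat (HV i b s j) ?orbT // => e' He'.
apply: HU; first exact: Hs.
apply: leq_trans Hd; elim: s He' {ss Hs} => //= e0 s IHs.
by rewrite inE leq_max => /predU1P[->|/IHs ->]; rewrite ?leqnn ?orbT.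
Qed.

(** Without an axis the paths g^n w would have bounded depth, since their ancestors are edges
    crossed by all sequences. They would then use finitely many edges, and a power of g would fix
    the base. *)
Lemma axis_nonempty w g : path_ww w g ->
  (forall k, run (base w) (pow g k) = base w -> k = 0) -> exists e, axis w g e.
Proof.
move=> Hg Hinf; apply: NNPP => Hno; pose f := sub w g.
pose crossing k k' d := forall cs, path_ww w cs ->
  run (base w) cs = run (base w) (pow g (k + k')) -> iter k f d \in edges_on w cs.
(* A periodic [d] has finitely many translates. A nonperiodic one is not on the axis, so for some
   [m] it has no such crossing with both exponents at least [m]. *)
have [m Hm] : exists m, forall d k k', d \in edges_on w g -> m <= k -> m <= k' ->
    crossing k k' d -> exists2 k0, k0 < m & iter k f d = iter k0 f d.
  have Hr d : d \in edges_on w g -> reach w d by apply: edges_on_reach Hg.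
  elim: (edges_on w g) Hr => [|d D IH] Hr; first by exists 0.
  have [|m Hm] := IH; first by move=> d' Hd'; apply: Hr; rewrite inE Hd' orbT.
  have [m' Hm'] : exists m', forall k k', m' <= k -> m' <= k' -> crossing k k' d ->
      exists2 k0, k0 < m' & iter k f d = iter k0 f d.
    have [[p p0 Hp]|Hper] := classic (exists2 p, 0 < p & iter p f d = d).
      exists p => k k' _ _ _; exists (k %% p); first by rewrite ltn_mod.
      by rewrite {1}(divn_eq k p) addnC iterD iter_period.
    apply: NNPP => Hm'; apply: Hno; exists d; split; first exact/Hr/mem_head.
      by move=> k Hk; apply/eqP; rewrite eqn0Ngt; apply/negP => k0; apply: Hper; exists k.
    move=> m0; apply: NNPP => H; apply: Hm'; exists m0 => k k' mk mk' Hc.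
    by exfalso; apply: H; exists k, k'.
  exists (maxn m m') => d' k k'; rewrite inE !geq_max => Hd' /andP[mk mk'] /andP[lk lk'].
  case/predU1P: Hd' => [->|Hd'] Hc.
    by have [k0 k0m ->] := Hm' _ _ mk' lk' Hc; exists k0; rewrite // leq_max k0m orbT.
  by have [k0 k0m ->] := Hm _ _ _ Hd' mk lk Hc; exists k0; rewrite // leq_max k0m.
(* Ancestors on g^n w are translates g^k d with d on [g]. The summands count those with k < m and
   those with n - k < m; [Hm] reduces the others to the first kind. *)
pose C := size (edges_on w g) * m + size (edges_on w g) * m.
have Hdepth n e : e \in run (base w) (pow g n) -> depth e <= C.
  pose l := [seq iter k f d | d <- edges_on w g, k <- iota 0 m] ++
            [seq iter (n - k) f d | d <- edges_on w g, k <- iota 0 m].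
  have <- : size l = C by rewrite size_cat !size_allpairs size_iota.
  move=> He; apply: anc_depth_bound (anc_mem He) => e' Ha.
  have Hall cs : path_ww w cs -> run (base w) cs = run (base w) (pow g n) ->
      e' \in edges_on w cs.
    by move=> Hc Er; apply: anc_edges_on Hc _; rewrite Er.
  have [k [d [kn Hd] Ed]] := edges_on_pow Hg (Hall _ (pow_path n Hg) erefl).
  rewrite Ed -/f mem_cat in Hall *; apply/orP.
  have [km|mk] := ltnP k m; first by left; apply: allpairs_f; rewrite ?mem_iota.
  have [nkm|mnk] := ltnP (n - k) m.
    by right; rewrite -{1}(subKn kn); apply: allpairs_f; rewrite ?mem_iota.
  have [|k0 k0m ->] := Hm d k (n - k) Hd mk mnk.
    by move=> cs Hc; rewrite subnKC //; apply: Hall.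
  by left; apply: allpairs_f; rewrite ?mem_iota.
have [U HU] := typed_finite (map (@c_rel S I) g) (size w) C.
have inU n e : e \in base w -> iter n f e \in U.
  move=> He; have Hin : iter n f e \in run (base w) (pow g n).
    by rewrite run_pow // map_f.
  apply: HU (Hdepth _ _ Hin).
  apply: (typed_run (pow_path n Hg) (base_good w)) Hin.
    move=> c; elim: n => //= n IH /List.in_app_iff[|/IH] //.
    exact: List.in_map.
  by move=> e' /mapP[j]; rewrite mem_iota => jw ->; constructor.
have [p p0 Hp] : exists2 p, 0 < p & forall e, e \in base w -> iter p f e = e.
  apply: common_period => e He.
  have [n|n1 [n2 [r [/andP[n12 _] <- E]]]] := @pigeonhole _ U (fun n r => iter n f e = r).
    by exists (iter n f e); rewrite ?inU.
  exists (n2 - n1); first by rewrite subn_gt0.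
  have Hre := reach_base He.
  apply: (iter_sub_inj (n := n1) Hg) => //; first exact: reach_iter.
  by rewrite -iterD subnKC // ltnW.
suff /Hinf p_eq : run (base w) (pow g p) = base w by rewrite p_eq in p0.
by rewrite run_pow // -[RHS]map_id; apply/eq_in_map.
Qed.

Lemma avoid_mem e cs j : forall L, avoid e L cs -> e \in L -> e \in run L (take j cs).
Proof.
elim: cs j => [|c cs IH] [|j] L //= [Hc Ha] He; apply: IH => //.
set p := size (c_pre c); set k := sz (c_rel c) (c_dir c).
have EL : L = take p L ++ take k (drop p L) ++ drop (p + k) L.
  by rewrite addnC -drop_drop !cat_take_drop.
move: He; rewrite {1}EL /actc -/p -/k !mem_cat => /or3P[->|He|->]; rewrite ?orbT //.
by rewrite He in Hc.
Qed.

(** A path through [e] and its translate by a power of [g] share [e], so a sequence avoiding [e]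
    joins them. It crosses g^k e' on a path that still contains [e]; translate back by g^-k. *)
Lemma axis_fixed_path w g e e' : path_ww w g -> axis w g e' -> reach w e -> sub w g e = e ->
  exists cs, exists2 v, is_path w cs v & (e \in run (base w) cs) && (e' \in run (base w) cs).
Proof.
move=> Hg He' [cs [v Hc He]] Hfix.
have [k [k' [_ _ Hk]]] := axis_crossing 0 Hg He' Hc.
have Hre : reach w e := reach_run Hc He.
have fixn n : iter n (sub w g) e = e by elim: n => //= n ->.
have Hpc := is_path_catI (pow_path (k + k') Hg) Hc.
have [ds [Hd Er Hav]] := avoid_common Hc Hpc.
rewrite (run_pow_cat _ Hg Hc) in Er Hav.
have [|j Hj] := Hk ds Hd; first by rewrite run_cat.
have [v' Hd'] := is_path_take j Hd.
have Hcd := is_path_catI Hc Hd'; have Hg' := is_path_pinv Hg.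
have Hed : e \in run (base w) (cs ++ take j ds).
  by rewrite run_cat; apply: avoid_mem => //; apply: Hav => //; rewrite -(fixn (k + k')) map_f.
exists (pow (pinv g) k ++ (cs ++ take j ds)), v'.
  exact: is_path_catI (pow_path k Hg') Hcd.
have invn n d : reach w d -> iter n (sub w (pinv g)) (iter n (sub w g) d) = d.
  move=> Hr; elim: n => // n IH; rewrite iterSr iterS.
  by rewrite (sub_pinvK Hg) ?IH //; apply: reach_iter.
have [He'r _ _] := He'; rewrite (run_pow_cat _ Hg' Hcd); apply/andP; split.
  by rewrite -{1}(invn k e Hre) fixn map_f.
by rewrite -{1}(invn k e' He'r) map_f.
Qed.

(** * From F to an idempotent *)

Section FromF.
Variables (w : seq S) (g : nat -> seq cell).
Hypothesis g_path : forall n, path_ww w (g n).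
Hypothesis g_rel : forall i j, i < j ->
  diag_equiv lhs rhs w w (dimg g [:: (i, false); (j, true); (i, true)]) (g j.+1).
Hypothesis g_inj : forall W, diag_equiv lhs rhs w w (dimg g W) [::] -> Feq W [::].

Let g'_path n : path_ww w (pinv (g n)). Proof. exact: is_path_pinv. Qed.

Local Notation t i := (sub w (g i)).
Local Notation t' i := (sub w (pinv (g i))).

Lemma gen_reach i e : reach w e -> reach w (t i e).
Proof. exact: reach_sub. Qed.

Lemma genV_reach i e : reach w e -> reach w (t' i e).
Proof. exact: reach_sub. Qed.

Lemma genK i e : reach w e -> t' i (t i e) = e.
Proof. exact: sub_pinvK. Qed.

Lemma genVK i e : reach w e -> t i (t' i e) = e.
Proof. exact: sub_pinvVK. Qed.

Lemma gen_inj i e e' : reach w e -> reach w e' -> t i e = t i e' -> e = e'.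
Proof. exact: sub_inj. Qed.

Lemma gen_swap i j e : i < j -> reach w e -> t j (t i e) = t i (t j.+1 e).
Proof.
move=> ij He; rewrite -(sub_dequiv (g_rel ij)) /dimg /= cats0.
rewrite (sub_cat (g'_path i) (is_path_catI (g_path j) (g_path i)) He).
rewrite (sub_cat (g_path j) (g_path i) He) genVK //.
by apply: gen_reach; apply: gen_reach.
Qed.

Lemma genV_swap i j e : i < j -> reach w e -> t' j (t i e) = t i (t' j.+1 e).
Proof.
move=> ij He; apply: (@gen_inj j); rewrite ?genVK //.
- exact/genV_reach/gen_reach.
- exact/gen_reach/genV_reach.
- by rewrite gen_swap ?genVK //; apply: genV_reach.
- exact: gen_reach.
Qed.

Lemma gen_swapV i j e : i < j -> reach w e -> t' i (t j e) = t j.+1 (t' i e).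
Proof.
move=> ij He; have [H1 H2] := (gen_reach j He, genV_reach i He).
by apply: (@gen_inj i); [exact: genV_reach|exact: gen_reach|rewrite genVK // -gen_swap // genVK].
Qed.

(** Conjugation by x_i with i < n only shifts the index of this element, and every x_j with j > n +
    1 commutes with it. This leaves room for a copy of F on either side. *)
Definition bump n : seq cell := g n ++ pinv (g n.+1).

Lemma bump_path n : path_ww w (bump n).
Proof. exact: is_path_catI (g_path n) (g'_path n.+1). Qed.

Lemma sub_bump n e : reach w e -> sub w (bump n) e = t n (t' n.+1 e).
Proof. exact: sub_cat. Qed.

Lemma bump_order n k : run (base w) (pow (bump n) k) = base w -> k = 0.
Proof.
move=> /(run_faithful (pow_path k (bump_path n))) H; apply: (@F_bump_order n).
apply: g_inj; suff <- : pow (bump n) k = dimg g (flatten (nseq k [:: (n, true); (n.+1, false)])).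
  by [].
by elim: k {H} => // k IH; rewrite /dimg /= -/(dimg _ _) -IH /bump -catA.
Qed.

Lemma gen_bump i n e : i < n -> reach w e -> t i (sub w (bump n.+1) e) = sub w (bump n) (t i e).
Proof.
move=> i_n He; rewrite !sub_bump //; last exact: gen_reach.
by rewrite -gen_swap ?genV_swap // ?(leqW i_n) //; apply: genV_reach.
Qed.

Lemma genV_bump i n e : i < n -> reach w e ->
  t' i (sub w (bump n) e) = sub w (bump n.+1) (t' i e).
Proof.
move=> i_n He; apply: (@gen_inj i).
- exact/genV_reach/(reach_sub (bump_path n)).
- exact/(reach_sub (bump_path n.+1))/genV_reach.
rewrite gen_bump ?genVK //; last exact: genV_reach.
exact: reach_sub (bump_path n) He.
Qed.

Lemma gen_bump_comm j n e : n.+1 < j -> reach w e ->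
  t j (sub w (bump n) e) = sub w (bump n) (t j e).
Proof.
move=> nj He; rewrite !sub_bump //; last exact: gen_reach.
by rewrite gen_swap ?(ltnW nj) -?gen_swapV //; apply: genV_reach.
Qed.

Lemma genV_bump_comm j n e : n.+1 < j -> reach w e ->
  t' j (sub w (bump n) e) = sub w (bump n) (t' j e).
Proof.
move=> nj He; have Hb := bump_path n; apply: (@gen_inj j).
- exact/genV_reach/(reach_sub Hb).
- exact/(reach_sub Hb)/genV_reach.
rewrite gen_bump_comm ?genVK //; last exact: genV_reach.
exact: reach_sub Hb He.
Qed.

Local Notation Ax n := (axis w (bump n)).

Lemma Ax_reach n e : Ax n e -> reach w e.
Proof. by case. Qed.

Lemma Ax_gen i n e : i < n -> Ax n.+1 e -> Ax n (t i e).
Proof.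
move=> i_n; apply: axis_conj (g_path i) (bump_path _) (bump_path _) _ => d.
exact: gen_bump.
Qed.

Lemma Ax_genV i n e : i < n -> Ax n e -> Ax n.+1 (t' i e).
Proof.
move=> i_n; apply: axis_conj (g'_path i) (bump_path _) (bump_path _) _ => d.
exact: genV_bump.
Qed.

Lemma Ax_gen_comm j n e : n.+1 < j -> Ax n e -> Ax n (t j e).
Proof.
move=> nj; apply: axis_conj (g_path j) (bump_path _) (bump_path _) _ => d.
exact: gen_bump_comm.
Qed.

Lemma Ax_genV_comm j n e : n.+1 < j -> Ax n e -> Ax n (t' j e).
Proof.
move=> nj; apply: axis_conj (g'_path j) (bump_path _) (bump_path _) _ => d.
exact: genV_bump_comm.
Qed.

Lemma Ax_iter_gen i n k e : i < n -> Ax (n + k) e -> Ax n (iter k (t i) e).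
Proof.
move=> i_n; elim: k n i_n => [|k IH] n i_n; first by rewrite addn0.
by rewrite -addSnnS => /(IH _ (leqW i_n)); apply: Ax_gen.
Qed.

Lemma Ax_iter_genV i n k e : i < n -> Ax n e -> Ax (n + k) (iter k (t' i) e).
Proof.
move=> i_n He; elim: k => [|k IH]; rewrite ?addn0 // addnS iterS.
by apply: Ax_genV => //; rewrite ltn_addr.
Qed.

(** [bump n] acts freely on its axis, with finitely many orbits by [axis_fin], and takes the role of
    the central element in [free_orbits_succ]. *)
Lemma Ax_succ n (y : nat -> edge -> edge) :
  (forall i e, Ax n e -> Ax n (y i e)) ->
  (forall i e e', Ax n e -> Ax n e' -> y i e = y i e' -> e = e') ->
  (forall i e, Ax n e -> y i (sub w (bump n) e) = sub w (bump n) (y i e)) ->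
  (forall i j e, i < j -> Ax n e -> y j (y i e) = y i (y j.+1 e)) ->
  forall j e, 0 < j -> Ax n e -> y j.+1 e = y j e.
Proof.
move=> yA y_inj y_comm y_rel.
apply: (@free_orbits_succ _ (Ax n) (sub w (bump n)) _ _ _ (edges_on w (bump n))) => //.
- by move=> e; apply: axis_conj (bump_path n) (bump_path n) (bump_path n) _ => d.
- by move=> e e' /Ax_reach He /Ax_reach He'; apply: (sub_inj (bump_path n)).
- by move=> e k [_ H _]; apply: H.
- by move=> e He; apply: (axis_fin (bump_path n) He).
Qed.

(** The copy of F on the right is generated by x_(n+2), x_(n+3), ...; only positive indices in this
    copy act alike, hence the bound [n + 3]. *)
Lemma Ax_right n j e : n + 3 <= j -> Ax n e -> t j.+1 e = t j e.
Proof.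
move=> nj He; have := @Ax_succ n (fun i => t (n.+2 + i)) _ _ _ _ (j - n.+2) e.
rewrite /= addnS subnKC; last by lia.
apply=> //; last by lia.
- by move=> i d; apply: Ax_gen_comm; lia.
- by move=> i d d' /Ax_reach Hd /Ax_reach Hd'; apply: gen_inj.
- by move=> i d /Ax_reach Hd; rewrite gen_bump_comm //; lia.
- by move=> i k d ik /Ax_reach Hd; rewrite gen_swap -?addnS //; lia.
Qed.

Lemma gen_reach_iter i k e : reach w e -> reach w (iter k (t i) e).
Proof. exact: reach_iter. Qed.

Lemma genV_reach_iter i k e : reach w e -> reach w (iter k (t' i) e).
Proof. exact: reach_iter. Qed.

Lemma iter_genK i k e : reach w e -> iter k (t' i) (iter k (t i) e) = e.
Proof. by move=> He; elim: k => // k IH; rewrite iterSr iterS genK ?IH //; apply: gen_reach_iter. Qed.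

Lemma iter_genVK i k e : reach w e -> iter k (t i) (iter k (t' i) e) = e.
Proof. by move=> He; elim: k => // k IH; rewrite iterSr iterS genVK ?IH //; apply: genV_reach_iter. Qed.

Lemma iter_gen_inj i k e e' : reach w e -> reach w e' ->
  iter k (t i) e = iter k (t i) e' -> e = e'.
Proof. by move=> He He' E; rewrite -(iter_genK i k He) E iter_genK. Qed.

Lemma iter_genV_inj i k e e' : reach w e -> reach w e' ->
  iter k (t' i) e = iter k (t' i) e' -> e = e'.
Proof. by move=> He He' E; rewrite -(iter_genVK i k He) E iter_genVK. Qed.

Lemma gen_iter0 j k e : 0 < j -> reach w e ->
  t j (iter k (t 0) e) = iter k (t 0) (t (j + k) e).
Proof.
move=> j0 He; elim: k j j0 => [|k IH] j j0; first by rewrite addn0.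
by rewrite iterS gen_swap //; [rewrite IH // addSnnS|apply: gen_reach_iter].
Qed.

Lemma genV_iter0 j k e : 0 < j -> reach w e ->
  iter k (t' 0) (t j e) = t (j + k) (iter k (t' 0) e).
Proof.
move=> j0 He; elim: k => [|k IH]; first by rewrite addn0.
by rewrite !iterS IH gen_swapV ?addnS //; [lia|apply: genV_reach_iter].
Qed.

(* The mirror images x_0^i x_1 x_0^(-i-1) of the generators: they satisfy the relations of
   F and commute with every [bump n], n >= 2, being supported to the left of it. *)
Definition left_gen i e := iter i (t 0) (t 1 (iter i.+1 (t' 0) e)).

Lemma left_gen_rel i j e : i < j -> reach w e ->
  left_gen j (left_gen i e) = left_gen i (left_gen j.+1 e).
Proof.
move=> ij He; rewrite /left_gen.
have [d Ed d0] : exists2 d, j = i + d & 0 < d by exists (j - i); lia.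
have R1 := genV_reach_iter 0 i.+1 He; have RQ := genV_reach_iter 0 j.+2 He.
have -> : iter j.+1 (t' 0) (iter i (t 0) (t 1 (iter i.+1 (t' 0) e))) =
    t (1 + d.+1) (iter j.+2 (t' 0) e).
  have -> : j.+1 = d.+1 + i by lia.
  rewrite iterD iter_genK; last exact: gen_reach.
  by rewrite genV_iter0 // -iterD [d.+1 + i.+1]addnS.
have -> : iter i.+1 (t' 0) (iter j.+1 (t 0) (t 1 (iter j.+2 (t' 0) e))) =
    iter d (t 0) (t 1 (iter j.+2 (t' 0) e)).
  have -> : j.+1 = i.+1 + d by lia.
  by rewrite [iter (_ + d) (t 0) _]iterD iter_genK //; apply/gen_reach_iter/gen_reach/genV_reach_iter.
rewrite gen_iter0 //; last exact: gen_reach.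
by rewrite -iterD -Ed [t (1 + d) _]gen_swap.
Qed.

Lemma Ax_left1 n e : 4 < n -> Ax n e -> t 2 e = t 1 e.
Proof.
move=> n4 He; have [m Em m1] : exists2 m, n = m + 3 & 1 < m by exists (n - 3); lia.
have m0 : 0 < m by lia.
rewrite Em in He; have Hm := Ax_iter_gen (i := 0) m0 He; have Hr := Ax_reach He.
(* The factor x_0^3 absorbs the negative powers in [left_gen 2] and [left_gen 1]; what remains is
   x_0^2 x_1 e = x_0 x_1 x_0 e = x_0^2 x_2 e. *)
have E : left_gen 2 (iter 3 (t 0) e) = left_gen 1 (iter 3 (t 0) e).
  apply: (@Ax_succ m left_gen) Hm => // [i d Hd|i d d'|i d|i j d ij].
  - apply: Ax_iter_gen => //; apply: Ax_gen; first by lia.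
    by rewrite -addnS; apply: Ax_iter_genV.
  - move=> /Ax_reach Hd /Ax_reach Hd' /iter_gen_inj E1.
    have [R R'] := (genV_reach_iter 0 i.+1 Hd, genV_reach_iter 0 i.+1 Hd').
    have {}E1 := gen_inj R R' (E1 (gen_reach _ R) (gen_reach _ R')).
    exact: iter_genV_inj E1.
  - move=> /Ax_reach Hd.
    have up k : iter k (t' 0) (sub w (bump m) d) = sub w (bump (m + k)) (iter k (t' 0) d).
      elim: k => [|k IH]; first by rewrite addn0.
      by rewrite !iterS IH addnS genV_bump //; [lia|apply: genV_reach_iter].
    have down k d' : reach w d' ->
        iter k (t 0) (sub w (bump (m + k)) d') = sub w (bump m) (iter k (t 0) d').
      elim: k d' => [|k IH] d' Hd'; first by rewrite addn0.
      by rewrite !iterSr addnS gen_bump ?IH //; [apply: gen_reach|lia].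
    have R := genV_reach_iter 0 i.+1 Hd.
    by rewrite /left_gen up addnS gen_bump ?down //; [apply: gen_reach|lia].
  - by move=> /Ax_reach Hd; apply: left_gen_rel.
have H2 := gen_reach 2 Hr; have H1 := gen_reach 1 Hr.
apply/esym; apply: (@iter_gen_inj 0 2) => //.
move: E; rewrite /left_gen iter_genK // [iter 2 (t' 0) _](_ : _ = t 0 e).
  by rewrite [t 1 (t 0 e)]gen_swap.
by rewrite [iter 3 _ _]iterSr iter_genK //; apply: gen_reach.
Qed.

(** A power of x_0 lowers the indices of the generators and of the axis together, which reduces the
    claim to [Ax_left1]. *)
Lemma Ax_left n i e : 0 < i -> i + 3 < n -> Ax n e -> t i.+1 e = t i e.
Proof.
case: i => // i _ i_n He; have Hr := Ax_reach He.
have [m Em m4] : exists2 m, n = m + i & 4 < m by exists (n - i); lia.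
have m0 : 0 < m by lia.
rewrite Em in He; have := Ax_left1 m4 (Ax_iter_gen m0 He).
by rewrite !gen_iter0 // => /iter_gen_inj ->; rewrite ?add1n //; apply: gen_reach.
Qed.

Lemma Ax_leftV n i e : 0 < i -> i + 2 < n -> Ax n e -> t' i.+1 e = t' i e.
Proof.
move=> i0 i_n He; have Hr := Ax_reach He.
have Hd : Ax n.+1 (t' i e) by apply: Ax_genV => //; lia.
have E : t i.+1 (t' i e) = e by rewrite (@Ax_left n.+1) ?genVK //; lia.
by rewrite -{1}E genK //; apply: genV_reach.
Qed.

Lemma Ax_iter_leftV n i k e : 0 < i -> i + 1 < n -> Ax n e ->
  iter k (t' i) e = iter k (t' 1) e.
Proof.
move=> i0 i_n He; have base_case m d : i + 1 < m -> Ax m d -> t' i d = t' 1 d.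
  case: i i0 {i_n} => // i _; elim: i => // i IH im Hd.
  by rewrite (@Ax_leftV m) //; [apply: IH => //; lia|lia].
elim: k => // k IH; rewrite !iterS IH; apply: (base_case (n + k)); first by lia.
by apply: Ax_iter_genV => //; lia.
Qed.

Lemma Ax_right_ge n i j e : n + 3 <= i -> n + 3 <= j -> Ax n e -> t i e = t j e.
Proof.
have H k d : Ax n d -> t (n + 3 + k) d = t (n + 3) d.
  by move=> Hd; elim: k => [|k IH]; rewrite ?addn0 // addnS (@Ax_right n) ?leq_addr.
by move=> ni nj He; rewrite -(subnKC ni) -(subnKC nj) !H.
Qed.

Lemma Ax_iter_comm n j k e : n.+1 < j -> Ax n e -> Ax n (iter k (t j) e).
Proof. by move=> nj He; elim: k => //= k; apply: Ax_gen_comm. Qed.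

Lemma split_word (v : seq S) A e Z e' B : size (A ++ e :: Z ++ e' :: B) = size v ->
  exists v1 a z a' v3, [/\ v = v1 ++ a :: z ++ a' :: v3, size A = size v1 & size Z = size z].
Proof.
rewrite size_cat /= size_cat /= => sv.
have [v1 [[|a z] [[|a' v3] [-> s1 s2 s3]]]] :=
  @split3 _ v (size A) (size Z).+1 (size B).+1 ltac:(by rewrite -sv; lia) => //.
by exists v1, a, z, a', v3; split=> //; case: s2.
Qed.

Lemma contains_F_idempotent : has_idempotent lhs rhs.
Proof.
have [e He] := axis_nonempty (bump_path 2) (@bump_order 2); have Hr := Ax_reach He.
(* On the axis of [bump 2] the generators x_5 and x_10 act alike, so f fixes e; on the axis of
   [bump 7], which contains y e, so do x_1^-1 and x_5^-1, so f and y agree there. *)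
pose yd := pow (pinv (g 1)) 5 ++ pow (g 10) 5.
pose fd := pow (pinv (g 5)) 5 ++ pow (g 10) 5.
have [[p1 p5] p10] := (pow_path 5 (g'_path 1), pow_path 5 (g'_path 5), pow_path 5 (g_path 10)).
have yd_path : path_ww w yd := is_path_catI p1 p10.
have fd_path : path_ww w fd := is_path_catI p5 p10.
have ydE d : reach w d -> sub w yd d = iter 5 (t' 1) (iter 5 (t 10) d).
  by move=> Hd; rewrite (sub_cat p1 p10) // !sub_pow //; apply: gen_reach_iter.
have fdE d : reach w d -> sub w fd d = iter 5 (t' 5) (iter 5 (t 10) d).
  by move=> Hd; rewrite (sub_cat p5 p10) // !sub_pow //; apply: gen_reach_iter.
set e1 := sub w yd e.
have He1 : Ax 7 e1.
  by rewrite /e1 ydE //; apply: (@Ax_iter_genV 1 2 5) => //; apply: Ax_iter_comm.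
have Hr1 := Ax_reach He1.
have fe : sub w fd e = e.
  have E k : iter k (t 10) e = iter k (t 5) e.
    elim: k => // k IH; rewrite !iterS IH; apply: (@Ax_right_ge 2) => //.
    exact: Ax_iter_comm.
  by rewrite fdE // E iter_genK.
have fe1 : sub w fd e1 = sub w yd e1.
  rewrite fdE // ydE //; apply: (@Ax_iter_leftV 7) => //.
  by apply: Ax_iter_comm.
(* [bump 7] is x_7 x_8^-1, and x_7 and x_8 act alike on the axis of [bump 2]. *)
have be : sub w (bump 7) e = e.
  rewrite sub_bump // (@Ax_right_ge 2 7 8) ?genVK //.
  by apply: Ax_genV_comm.
(* [e1] is not periodic under [bump 7], whereas [e] is fixed. *)
have ne : e1 != e.
  apply/eqP => E; have [_ Hn _] := He1; have := Hn 1; rewrite /= E be.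
  by move=> /(_ erefl).
have [cs [v Hc /andP[He0 He10]]] := axis_fixed_path (bump_path 7) He1 Hr be.
have [sL _ _] := base_run_good Hc.
have Hyc := is_path_catI yd_path Hc; have Hfc := is_path_catI fd_path Hc.
have Ey := sub_run yd_path Hc; have Ef := sub_run fd_path Hc.
have [A [B EL]] : exists A B, run (base w) cs = A ++ e :: B.
  by case/splitPr: He0 => A B; exists A, B.
(* The path through [e] and [e1] and its images under y and f carry (e, y e), (y e, y^2 e) and (e,
   y^2 e). If [e1] comes first, the pairs are read backwards and the first two paths exchange
   roles. *)
move: He10; rewrite EL mem_cat inE (negPf ne) /= orbC => /orP[] /splitPr EB.
- case: EB EL => Z B' EL; rewrite EL in sL Ey Ef.
  have [v1 [a [z [a' [v3 [Ev sA sZ]]]]]] := split_word sL; rewrite Ev in Hc Hyc Hfc.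
  rewrite !map_cat /= !map_cat /= ?fe ?fe1 -/e1 in Ey Ef.
  by apply: (idempotent_of_edges Hc Hyc Hfc EL (esym Ey) (esym Ef)); rewrite ?size_map.
case: EB EL => A' Z EL; rewrite -catA /= in EL; rewrite EL in sL Ey Ef.
have [v1 [a [z [a' [v3 [Ev sA sZ]]]]]] := split_word sL; rewrite Ev in Hc Hyc Hfc.
rewrite !map_cat /= !map_cat /= ?fe ?fe1 -/e1 in Ey Ef.
by apply: (idempotent_of_edges Hyc Hc Hfc (esym Ey) EL (esym Ef)); rewrite ?size_map.
Qed.

End FromF.

End TwoTree.

Theorem theorem1 (S I : Type) (lhs rhs : I -> seq S)
  (Hne : forall i, lhs i <> [::] /\ rhs i <> [::]) :
  (exists w : seq S, w <> [::] /\ contains_F lhs rhs w) <->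
  has_idempotent lhs rhs.
Proof.
split=> [[w [_ [g [Hp [Hr Hi]]]]]|[u [u0 Hu]]].
  exact: contains_F_idempotent Hp Hr Hi.
by exists u; split=> //; apply: idempotent_contains_F.
Qed.
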